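(* Let $n$ denote a positive integer. (1) Let $c\ge11$ be an integer. Then $B(n,2n-c)\ne\emptyset$ if and only if $n=c/2$ or $c-4\le n\le c-2$. (2) $B(n,2n-10)\ne\emptyset$ if and only if $n\ge5$. Further, if $n\ge9$ and $\mathcal{B}\in B(n,2n-10)$, then $\mathcal{B}\simeq\mathcal{T}_{n,i}$ for some $1\le i\le\lceil\frac{n-5}{2}\rceil$. (3) For all $6\le n<9$, there exists a betweenness structure $\mathcal{B}\in B(n,2n-10)$ such that $\mathcal{B}\not\simeq\mathcal{T}_{n,i}$ for any $1\le i\le\lceil\frac{n-5}{2}\rceil$.
   Context: A betweenness structure is a pair $\mathcal{B}=(X,\beta)$ where $X$ is a nonempty finite set and $\beta\subseteq X^3$; write $(x\ y\ z)$ for $(x,y,z)\in\beta$. All betweenness structures are assumed to be almost-metrizable, i.e. for all $x,y,z,w\in X$: (P1) $(x\ x\ z)$; (P2) $(x\ y\ z)\Rightarrow(z\ y\ x)$; (P3) $(x\ y\ z)\wedge(y\ x\ z)\Rightarrow x=y$; (P4) $(x\ y\ z)\wedge(x\ w\ y)\Rightarrow(x\ w\ z)\wedge(w\ y\ z)$. The order of $\mathcal{B}$ is $|X|$. A set of three distinct points is collinear if some ordering of it is in $\beta$; otherwise it is a triangle. The co-size of $\mathcal{B}$ is its number of triangles. $B(n,m)$ is the set of betweenness structures of order $n$ and co-size $m$ (empty if $m<0$). $\simeq$ denotes isomorphism, i.e. existence of a bijection of ground sets preserving betweenness in both directions. For $n\ge6$ and $1\le i\le\lceil\frac{n-5}{2}\rceil$,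 $T_{n,i}$ is the simple (unit-weight) graph with vertices $x_1,\dots,x_{n-4},y,z,u,v$ and edges $\{x_j,x_{j+1}\}$ for $1\le j\le n-5$, $j\ne i$, together with $\{x_i,y\},\{x_i,z\},\{y,u\},\{y,v\},\{z,u\},\{z,v\},\{u,x_{i+1}\},\{v,x_{i+1}\}$. $\mathcal{T}_{n,i}$ is the betweenness structure induced by $T_{n,i}$: its ground set is the vertex set, and $(x\ y\ z)$ holds iff $d(x,z)=d(x,y)+d(y,z)$ for the graph distance $d$ of $T_{n,i}$. *)

(* Defs.v *)
From HB Require Import structures.
From mathcomp Require Import all_boot all_order all_algebra.
From mathcomp Require Import zify.

Set Implicit Arguments.
Unset Strict Implicit.
Unset Printing Implicit Defensive.

Record betweenness : Type := Betweenness {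
  point : finType;
  btw : {set point * point * point};
  btw_nonempty : 0 < #|point|;
  btw_P1 : forall x z : point, (x, x, z) \in btw;
  btw_P2 : forall x y z : point, (x, y, z) \in btw -> (z, y, x) \in btw;
  btw_P3 : forall x y z : point,
    (x, y, z) \in btw -> (y, x, z) \in btw -> x = y;
  btw_P4 : forall x y z w : point,
    (x, y, z) \in btw -> (x, w, y) \in btw ->
    (x, w, z) \in btw /\ (w, y, z) \in btw
}.

(* Meant for three-element sets [A], where it says that some ordering of the
   elements of [A] is in the betweenness relation. *)
Definition collinear (B : betweenness) (A : {set point B}) : bool :=
  [exists x, exists y, exists z,
    (A == [set x; y; z]) && ((x, y, z) \in btw B)].

Definition triangles (B : betweenness) : {set {set point B}} :=
  [set A : {set point B} | (#|A| == 3) && ~~ collinear A].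

Definition co_size (B : betweenness) : nat := #|triangles B|.

(* The class B(n, m); [m] is an integer, and the class is empty if [m < 0]. *)
Definition in_B (n : nat) (m : int) (B : betweenness) : Prop :=
  #|point B| = n /\ Posz (co_size B) = m.

Definition isomorphic (B C : betweenness) : Prop :=
  exists f : point B -> point C, bijective f /\
    forall x y z : point B,
      (x, y, z) \in btw B <-> (f x, f y, f z) \in btw C.

Section GraphDistance.

Variables (T : finType) (e : rel T).

Definition walk (k : nat) (x y : T) : bool :=
  [exists p : k.-tuple T, path e x p && (last x p == y)].

(* The least length of a walk from [x] to [y]. A shortest walk has length
   less than [#|T|]; the value is [#|T|] if [x] and [y] are not connected. *)
Definition gdist (x y : T) : nat := find (fun k => walk k x y) (iota 0 #|T|).

Lemma walkP k x y :
  reflect (exists p : seq T, [/\ size p = k, path e x p & last x p = y])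
          (walk k x y).
Proof.
apply: (iffP existsP) => [[p /andP[ep /eqP lp]]|[p [sp ep lp]]].
  by exists p; rewrite size_tuple.
by exists (tcast sp (in_tuple p)); rewrite val_tcast ep lp eqxx.
Qed.

Lemma gdist_max x y : gdist x y <= #|T|.
Proof. by rewrite -[leqRHS](size_iota 0) find_size. Qed.

Lemma gdist_walk x y : gdist x y < #|T| -> walk (gdist x y) x y.
Proof.
move=> lt_d; have := lt_d; rewrite -[X in _ < X](size_iota 0) -has_find.
by move/(nth_find 0); rewrite nth_iota.
Qed.

Lemma gdist_le k x y : walk k x y -> gdist x y <= k.
Proof.
move=> wk; have [lt_kT|/(leq_trans (gdist_max x y))//] := ltnP k #|T|.
rewrite leqNgt; apply/negP => lt_kd.
by have := before_find 0 lt_kd; rewrite nth_iota // wk.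
Qed.

Lemma gdist_refl x : gdist x x = 0.
Proof.
by apply/eqP; rewrite -leqn0; apply: gdist_le; apply/walkP; exists [::].
Qed.

Lemma gdist_eq0 x y : gdist x y = 0 -> x = y.
Proof.
move=> d0; have: walk (gdist x y) x y.
  by apply: gdist_walk; rewrite d0; apply/card_gt0P; exists x.
by rewrite d0 => /walkP[[|a p] [// _ _ lp]].
Qed.

Lemma gdist_triangle x y z : gdist x z <= gdist x y + gdist y z.
Proof.
have [/gdist_walk/walkP[p [sp ep lp]]|] := ltnP (gdist x y) #|T|; last first.
  by move=> ?; have := gdist_max x z; lia.
have [/gdist_walk/walkP[q [sq eq lq]]|] := ltnP (gdist y z) #|T|; last first.
  by move=> ?; have := gdist_max x z; lia.
apply: gdist_le; apply/walkP; exists (p ++ q).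
by rewrite size_cat sp sq cat_path last_cat ep lp eq.
Qed.

Hypothesis e_sym : symmetric e.

Lemma walk_sym k x y : walk k x y -> walk k y x.
Proof.
case/walkP=> p [sp ep lp]; apply/walkP; exists (rev (belast x p)).
split; first by rewrite size_rev size_belast.
  by rewrite -lp rev_path (eq_path (e' := e)) // => a b; rewrite e_sym.
by case: p {sp ep} lp => [<-//|a p _] /=; rewrite rev_cons last_rcons.
Qed.

Lemma gdist_sym x y : gdist x y = gdist y x.
Proof.
by apply: eq_find => k; apply/idP/idP; apply: walk_sym.
Qed.

Definition graph_btw : {set T * T * T} :=
  [set t | gdist t.1.1 t.2 == gdist t.1.1 t.1.2 + gdist t.1.2 t.2].

Lemma graph_btwE x y z :
  ((x, y, z) \in graph_btw) = (gdist x z == gdist x y + gdist y z).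
Proof. by rewrite inE. Qed.

Lemma graph_P1 x z : (x, x, z) \in graph_btw.
Proof. by rewrite graph_btwE gdist_refl. Qed.

Lemma graph_P2 x y z : (x, y, z) \in graph_btw -> (z, y, x) \in graph_btw.
Proof.
by rewrite !graph_btwE (gdist_sym z x) (gdist_sym z y) (gdist_sym y x) addnC.
Qed.

Lemma graph_P3 x y z :
  (x, y, z) \in graph_btw -> (y, x, z) \in graph_btw -> x = y.
Proof.
rewrite !graph_btwE (gdist_sym y x) => /eqP h1 /eqP h2.
by apply: gdist_eq0; lia.
Qed.

Lemma graph_P4 x y z w :
  (x, y, z) \in graph_btw -> (x, w, y) \in graph_btw ->
  (x, w, z) \in graph_btw /\ (w, y, z) \in graph_btw.
Proof.
rewrite !graph_btwE => /eqP h1 /eqP h2.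
have := gdist_triangle x w z; have := gdist_triangle w y z.
by split; apply/eqP; lia.
Qed.

Hypothesis T_nonempty : 0 < #|T|.

Definition graph_betweenness : betweenness :=
  Betweenness T_nonempty graph_P1 graph_P2 graph_P3 graph_P4.

End GraphDistance.

Variant quad : Type := Qy | Qz | Qu | Qv.

Definition quad_code (q : quad) : bool * bool :=
  match q with
  | Qy => (false, false)
  | Qz => (false, true)
  | Qu => (true, false)
  | Qv => (true, true)
  end.

Definition quad_decode (b : bool * bool) : quad :=
  match b with
  | (false, false) => Qy
  | (false, true) => Qz
  | (true, false) => Qu
  | (true, true) => Qv
  end.

Lemma quad_codeK : cancel quad_code quad_decode.
Proof. by case. Qed.

HB.instance Definition _ := Finite.copy quad (can_type quad_codeK).

(* [inl j] is the vertex x_(j+1), so the x's are x_1, ..., x_(n-4). *)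
Definition T_vertex (n : nat) : finType := ('I_(n - 4) + quad)%type.

(* Each edge is listed in one direction here, with indices counted from 1. *)
Definition T_arc (n i : nat) (a b : T_vertex n) : bool :=
  match a, b with
  | inl j, inl k => (k.+1 == j.+1 + 1) && (j.+1 != i)
  | inl j, inr Qy | inl j, inr Qz => j.+1 == i
  | inr Qy, inr Qu | inr Qy, inr Qv | inr Qz, inr Qu | inr Qz, inr Qv => true
  | inr Qu, inl k | inr Qv, inl k => k.+1 == i + 1
  | _, _ => false
  end.

Definition T_edge (n i : nat) : rel (T_vertex n) :=
  fun a b => T_arc i a b || T_arc i b a.

Lemma T_edge_sym (n i : nat) : symmetric (@T_edge n i).
Proof. by move=> a b; rewrite /T_edge orbC. Qed.

Lemma T_vertex_nonempty (n : nat) : 0 < #|T_vertex n|.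
Proof. by apply/card_gt0P; exists (inr Qy). Qed.

(* T_(n,i), intended for [6 <= n] and [1 <= i <= n - 5], where the graph is
   connected. *)
Definition T_betweenness (n i : nat) : betweenness :=
  graph_betweenness (@T_edge_sym n i) (T_vertex_nonempty n).

(* Main.v *)
(** Deleting points one at a time reduces everything to one order.  A set of at
    least five points without triangles is linearly ordered: a new point enters
    an ordered set of at least four points through a gap.  If [c] and [p] both
    enter an ordered set [K] without triangles, then either [K], [c], [p] is
    still free of triangles, or [{c, p, k}] is a triangle for all but at most
    two points [k] of [K]; exactly two points are missing only if [c] and [p]
    share an inner gap (and form a four-cycle with its two ends) or lie beyond
    opposite ends of [K].  A set [S] of order [n] is called [shared] if all its
    triangles contain one fixed pair of points; it then has [0], [n-4], [n-3] or
    [n-2] triangles.  By induction on [n], fewer than [2n-10] triangles force [S]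
    to be shared: averaging gives a point [p] such that [S \ p] is shared by some
    pair [{q, r}]; if [S] is not shared, then the triangles on [{q, r}] and those
    that avoid [q] are at least [n-5] each.  With exactly [2n-10] triangles both
    families are tight, so they consist of the triangles on two pairs [{p, z}]
    and [{q, r}], each pair filling one gap of the order on the remaining points,
    and the two gaps are consecutive.  This is [T_(n,i)], where [d] is the
    distance between positions, with value 2 inside a pair. *)
Require Import Defs.
From mathcomp Require Import all_boot all_order all_algebra.
From mathcomp Require Import zify.

Set Implicit Arguments.
Unset Strict Implicit.
Unset Printing Implicit Defensive.

(** The thresholds come from two sources. A four-cycle has no triangle and yet no linear order. So
    [cut_exists] asks for four points and the linear order for five. An argument that removes three
    points and keeps four therefore starts at order 7, and order 6 rests on a finite check. The
    other source is the least nonzero number of triangles, [n - 4] in order [n]. After one deletion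
    it is [n - 5], and two disjoint families of that size give [2n - 10]. For [c >= 11] the co-size
    [2n - c] is below [2n - 10], so it is one of [0], [n - 4], [n - 3], [n - 2]; this gives
    [n = c/2], [c - 4], [c - 3], [c - 2]. For [c = 10] the last three values equal [2n - 10] at
    [n = 6], [7], [8], which produces the exceptional structures there. From [n = 9] on, [2n - 10]
    exceeds [n - 2], so the whole structure cannot be shared. The case where deleting one point
    leaves no triangle is proved with the bound [2n - 10] included, because the extremal part uses
    it at equality. *)

Section Collinearity.

Variable B : betweenness.
Local Notation X := (point B).
Implicit Types (x y z w k p q r a b c : X) (S K : {set X}).

Definition between x y z : bool := (x, y, z) \in btw B.

Lemma between_refl x z : between x x z. Proof. exact: btw_P1. Qed.

Lemma between_sym x y z : between x y z -> between z y x. Proof. exact: btw_P2. Qed.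

Lemma between_anti x y z : between x y z -> between y x z -> x = y.
Proof. exact: btw_P3. Qed.

Lemma between_tr1 x y z w : between x y z -> between x w y -> between x w z.
Proof. by move=> h1 h2; case: (btw_P4 h1 h2). Qed.

Lemma between_tr2 x y z w : between x y z -> between x w y -> between w y z.
Proof. by move=> h1 h2; case: (btw_P4 h1 h2). Qed.

Lemma between_refl2 x z : between x z z.
Proof. exact/between_sym/between_refl. Qed.

(* Triples with a repeated point are collinear by (P1), so [noncol] implies
   distinctness. *)
Definition noncol x y z : bool := ~~ [|| between x y z, between y z x | between z x y].

Lemma noncol_rot x y z : noncol x y z = noncol y z x.
Proof. by rewrite /noncol; congr (~~ _); rewrite orbCA orbA orbC;
  do 3!case: (between _ _ _). Qed.

Lemma between_symE x y z : between x y z = between z y x.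
Proof. by apply/idP/idP; apply: between_sym. Qed.

Lemma noncol_swap x y z : noncol x y z = noncol y x z.
Proof.
by rewrite /noncol (between_symE x y z) (between_symE y z x) (between_symE z x y);
  do 3!case: (between _ _ _).
Qed.

Lemma noncol_swapr x y z : noncol x y z = noncol x z y.
Proof. by rewrite noncol_swap noncol_rot. Qed.

Lemma noncol_xx x y : noncol x x y = false.
Proof. by rewrite /noncol between_refl. Qed.

Lemma noncol_xyx x y : noncol x y x = false.
Proof. by rewrite noncol_swapr noncol_xx. Qed.

Lemma noncol_xyy x y : noncol x y y = false.
Proof. by rewrite noncol_rot noncol_xx. Qed.

Lemma between_noncol x y z : between x y z -> noncol x y z = false.
Proof. by rewrite /noncol => ->. Qed.

Definition triangle_free S := forall x y z, x \in S -> y \in S -> z \in S ->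
  ~~ noncol x y z.

Definition ordered S (pos : X -> nat) :=
  {in S &, injective pos} /\
  forall x y z, x \in S -> y \in S -> z \in S ->
    pos x < pos y -> pos y < pos z -> between x y z.

(* [c] lies between the points of [K] at positions below [g] and the others. *)
Definition cut K (pos : X -> nat) g c :=
  [/\ forall x y, x \in K -> y \in K -> pos x < pos y -> pos y < g -> between x y c,
      forall x y, x \in K -> y \in K -> g <= pos x -> pos x < pos y -> between c x y &
      forall x y, x \in K -> y \in K -> pos x < g -> g <= pos y -> between x c y].

Lemma colP x y z : ~~ noncol x y z -> [\/ between x y z, between y z x | between z x y].
Proof. by rewrite /noncol negbK => /or3P. Qed.

End Collinearity.

(** Repeated facts, and facts whose middle point is one of the ends, are refused, so that [saturate]
    adds only finitely many facts. Contradictions are then found through (P3). *)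
Ltac add_between t :=
  lazymatch type of t with
  | is_true (between ?a ?b ?c) =>
     lazymatch a with b => fail | _ => lazymatch c with b => fail | _ =>
     lazymatch goal with
     | _ : is_true (between a b c) |- _ => fail
     | _ => have := t; intro
     end end end
  end.

Lemma between_contra (B : betweenness) (x y z : point B) :
  x != y -> between x y z -> between y x z -> False.
Proof. by move=> /eqP n h1 h2; apply/n/(between_anti h1 h2). Qed.

(* [zify] interprets every boolean hypothesis, which makes [lia] explode when
   many facts about [between] are in context. *)
Ltac pos_lia :=
  repeat match goal with
  | H : ?T |- _ =>
    lazymatch T with
    | is_true (leq _ _) => fail
    | @eq nat _ _ => fail
    | is_true (@eq_op Datatypes_nat__canonical__eqtype_Equality _ _) => fail
    | is_true (~~ (@eq_op Datatypes_nat__canonical__eqtype_Equality _ _)) => fail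
    | is_true (_ || _) => fail
    | is_true (_ && _) => fail
    | _ \/ _ => fail
    | _ /\ _ => fail
    | _ => clear H
    end
  end; lia.

Ltac conflict :=
  match goal with
  | N : is_true (?x != ?y), H1 : is_true (between ?x ?y ?z),
    H2 : is_true (between ?y ?x ?z) |- _ =>
     case: (between_contra N H1 H2)
  | N : is_true (?y != ?x), H1 : is_true (between ?x ?y ?z),
    H2 : is_true (between ?y ?x ?z) |- _ =>
     case: (between_contra N H2 H1)
  end.

Ltac saturate :=
  repeat match goal with
  | _ => conflict
  | H : is_true (between ?x ?y ?z) |- _ => add_between (between_sym H)
  | H1 : is_true (between ?x ?y ?z), H2 : is_true (between ?x ?w ?y) |- _ =>
      first [add_between (between_tr1 H1 H2) | add_between (between_tr2 H1 H2)]
  end.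

Ltac between_auto := saturate; try assumption.

(** * Ordered sets *)

Section Insertion.

Variable B : betweenness.
Local Notation X := (point B).
Implicit Types (x y z w k p q r a b c : X) (S K : {set X}).

Lemma card_gt3_other K x y z : 3 < #|K| -> exists2 w, w \in K & [/\ w != x,
  w != y & w != z].
Proof.
move=> hK; have : 0 < #|K :\: [set x; y; z]|.
  rewrite cardsD; have := subset_leq_card (subsetIr K [set x; y; z]).
  have := (leq_card_setU [set x; y] [set z]).1.
  have := (leq_card_setU [set x] [set y]).1.
  by move: #|_ :|: _| => m; rewrite !cards1; pos_lia.
case/card_gt0P => w; rewrite !inE !negb_or => /andP[/andP[/andP[? ?] ?] ?].
by exists w.
Qed.

(* A pair [x], [y] of [K] with [c] in between and [pos y - pos x] minimal turns
   out to be consecutive. *)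
Lemma cut_exists K (pos : X -> nat) c : ordered K pos -> 3 < #|K| ->
  (forall x y, x \in K -> y \in K -> ~~ noncol c x y) -> c \notin K ->
  exists g, cut K pos g c.
Proof.
move=> [inj ord] hK cK cnK.
have neq x : x \in K -> x != c by move=> xK; apply: contraNneq cnK => <-.
have tri x y : x \in K -> y \in K -> pos x < pos y ->
  [\/ between c x y, between x c y | between x y c].
  move=> xK yK _; case: (colP (cK x y xK yK)) => h; [by constructor 1| | ].
    by constructor 3.
  by constructor 2; exact: between_sym.
have [/existsP[x0 /existsP[y0 /and4P[x0K y0K lt0 M0]]]|noM] :=
  boolP [exists x, exists y, [&& x \in K, y \in K, pos x < pos y & between x c y]].
  have [n] := ubnP (pos y0 - pos x0).
  elim: n x0 y0 x0K y0K lt0 M0 => // n IH x y xK yK lxy Mxy hn.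
  have nxc := neq x xK; have nyc := neq y yK.
  have [/existsP[z /and3P[zK lxz lzy]]|none] :=
    boolP [exists z, [&& z \in K, pos x < pos z & pos z < pos y]].
    have nzc := neq z zK.
    have oxzy := ord _ _ _ xK zK yK lxz lzy.
    have nxy : x != y by apply: contraTneq lxy => ->; rewrite ltnn.
    have nxz : x != z by apply: contraTneq lxz => ->; rewrite ltnn.
    have nzy : z != y by apply: contraTneq lzy => ->; rewrite ltnn.
    have [Lxz|Mxz|Rxz] := tri x z xK zK lxz; last first.
    - by apply: (IH z y) => //; [between_auto|pos_lia].
    - by apply: (IH x z) => //; pos_lia.
    have [Lzy|Mzy|Rzy] := tri z y zK yK lzy; [between_auto| |].
      by apply: (IH z y) => //; pos_lia.
    (* What survives is the four-cycle [x], [z], [y], [c]. Wherever a fourth point [w] of [K] lies,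
       it yields a contradiction or a closer pair around [c]. *)
    have [w wK [nwx nwy nwz]] := card_gt3_other x y z hK.
    have nwc := neq w wK.
    have case3 a b : a \in K -> b \in K -> a != b ->
       [\/ pos a < pos b | pos b < pos a].
      move=> aK bK nab; have := inj a b aK bK.
      by case: ltngtP => // e h; [left|right|move: nab; rewrite h ?eqxx].
    have [lwx|lxw] := case3 w x wK xK nwx.
      have o1 := ord w x y wK xK yK lwx lxy.
      have o2 := ord w x z wK xK zK lwx lxz.
      have o3 := ord w z y wK zK yK (ltn_trans lwx lxz) lzy.
      by have [h|h|h] := tri w z wK zK (ltn_trans lwx lxz); between_auto.
    have [lwy|lyw] := case3 w y wK yK nwy; last first.
      have o1 := ord x y w xK yK wK lxy lyw.
      have o2 := ord z y w zK yK wK lzy lyw.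
      have o3 := ord x z w xK zK wK lxz (ltn_trans lzy lyw).
      by have [h|h|h] := tri z w zK wK (ltn_trans lzy lyw); between_auto.
    have o1 := ord x w y xK wK yK lxw lwy.
    have [h1|h1|h1] := tri x w xK wK lxw; last first.
    - by apply: (IH w y) => //; [between_auto|pos_lia].
    - by apply: (IH x w) => //; pos_lia.
    have [h2|h2|h2] := tri w y wK yK lwy; [by between_auto|by apply: (IH w y) => //;
      pos_lia|].
    have [lwz|lzw] := case3 w z wK zK nwz.
      have o2 := ord x w z xK wK zK lxw lwz.
      have o3 := ord w z y wK zK yK lwz lzy.
      by have [h|h|h] := tri w z wK zK lwz; between_auto.
    have o2 := ord x z w xK zK wK lxz lzw.
    have o3 := ord z w y zK wK yK lzw lwy.
    by have [h|h|h] := tri z w zK wK lzw; between_auto.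
  (* Now [x] and [y] are neighbours in [K] with [c] between them. By (P4) this extends to the points
     beyond [y] and beyond [x], so the upper side of the gap starts at [pos y]. *)
  have up b : b \in K -> pos y < pos b -> between x c b /\ between c y b.
    move=> bK lb; have o1 := ord x y b xK yK bK lxy lb.
    by split; between_auto.
  have dn b : b \in K -> pos b < pos x -> between b c y /\ between b x c.
    move=> bK lb; have o1 := ord b x y bK xK yK lb lxy.
    by split; between_auto.
  have le_x a : a \in K -> pos a < pos y -> a = x \/ pos a < pos x.
    move=> aK lay; have := existsPn none a; rewrite aK lay andbT /= -leqNgt.
    by rewrite leq_eqVlt => /orP[/eqP/inj->//|?]; [left|right].
  have ge_y a : a \in K -> pos y <= pos a -> a = y \/ pos y < pos a.
    by move=> aK; rewrite leq_eqVlt => /orP[/eqP/inj->//|?]; [left|right].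
  exists (pos y); split => [a b aK bK lab lb|a b aK bK la lab|a b aK bK la lb].
  - have [eb|lbx] := le_x b bK lb; first by subst b; case: (dn a aK lab).
    have [_ h1] := dn a aK (ltn_trans lab lbx).
    have o1 := ord a b x aK bK xK lab lbx.
    by between_auto.
  - have [ea|lya] := ge_y a aK la; first by subst a; case: (up b bK lab).
    have [_ h1] := up b bK (ltn_trans lya lab).
    have o1 := ord y a b yK aK bK lya lab.
    by between_auto.
  - have [ea|lax] := le_x a aK la.
      subst a; have [->//|lyb] := ge_y b bK lb.
      by case: (up b bK lyb).
    have [h1 h2] := dn a aK lax.
    have [->//|lyb] := ge_y b bK lb.
    have o1 := ord a y b aK yK bK (ltn_trans lax lxy) lyb.
    by between_auto.
have tri2 x y : x \in K -> y \in K -> pos x < pos y -> between c x y || between x y c.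
  move=> xK yK lxy; case: (tri x y xK yK lxy) => [->//|M|->]; last by rewrite orbT.
  case/negP: noM; apply/existsP; exists x; apply/existsP; exists y.
  by rewrite xK yK lxy.
(* With [c] inside no pair, [L] tells on which side of a pair it lies. The three pairs of a triple
   agree, hence all pairs do, and the gap is at [0] or one above the largest position. *)
pose L x y := if pos x < pos y then between c x y else between c y x.
have Lsym x y : x \in K -> y \in K -> L x y = L y x.
  rewrite /L => xK yK; case: ltngtP => // e.
  by rewrite (inj x y xK yK e).
have three x y z : x \in K -> y \in K -> z \in K -> pos x < pos y -> pos y < pos z ->
   L x y = L y z /\ L y z = L x z.
  move=> xK yK zK lxy lyz; rewrite /L lxy lyz (ltn_trans lxy lyz).
  have o1 := ord x y z xK yK zK lxy lyz.
  have nx := neq x xK; have ny := neq y yK; have nz := neq z zK.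
  have nxy : x != y by apply: contraTneq lxy => ->; rewrite ltnn.
  have nxz : x != z by apply: contraTneq (ltn_trans lxy lyz) => ->; rewrite ltnn.
  have nyz : y != z by apply: contraTneq lyz => ->; rewrite ltnn.
  have t1 := tri2 x y xK yK lxy; have t2 := tri2 y z yK zK lyz.
  have t3 := tri2 x z xK zK (ltn_trans lxy lyz).
  move: t1 t2 t3; case: (boolP (between c x y)) => E1;
    case: (boolP (between c y z)) => E2;
    case: (boolP (between c x z)) => E3 //= t1 t2 t3; exfalso; by between_auto.
have gen x y z : x \in K -> y \in K -> z \in K -> x != y -> x != z ->
    L x y = L x z.
  move=> xK yK zK nxy nxz; have [->//|nyz] := eqVneq y z.
  have d a b : a \in K -> b \in K -> a != b -> pos a != pos b.
    by move=> aK bK; apply: contraNneq => /inj->.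
  have := d x y xK yK nxy; have := d x z xK zK nxz; have := d y z yK zK nyz.
  rewrite !neq_ltn => /orP[lyz|lyz] /orP[lxz|lxz] /orP[lxy|lxy]; try pos_lia.
  - by have [-> ->] := three x y z xK yK zK lxy lyz.
  - by have [e1 e2] := three y x z yK xK zK lxy lxz; rewrite (Lsym x y).
  - by have [e1 e2] := three y z x yK zK xK lyz lxz;
    rewrite (Lsym x y) // (Lsym x z) // e2.
  - by have [e1 e2] := three x z y xK zK yK lxz lyz; rewrite -e2 -e1.
  - by have [e1 e2] := three z x y zK xK yK lxz lxy; rewrite (Lsym x z).
  - by have [e1 e2] := three z y x zK yK xK lyz lxy;
    rewrite (Lsym x y) // (Lsym x z) // e2.
have all x y a b : x \in K -> y \in K -> a \in K -> b \in K -> x != y -> a != b ->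
    L x y = L a b.
  move=> xK yK aK bK nxy nab; have [e|nax] := eqVneq x a; first by subst a; apply: gen.
  rewrite (gen x y a) // Lsym // (gen a x b) //; by rewrite eq_sym.
have ltn_neq x y : pos x < pos y -> x != y.
  by apply: contraTneq => ->; rewrite ltnn.
have [/existsP[x /existsP[y /and4P[xK yK nxy Lxy]]]|nL] :=
  boolP [exists x, exists y, [&& x \in K, y \in K, x != y & L x y]].
  exists 0; split=> // a b aK bK _ lab.
  by have := all x y a b xK yK aK bK nxy (ltn_neq _ _ lab); rewrite Lxy /L lab.
exists (\max_(x in K) pos x).+1.
have bnd x : x \in K -> pos x < (\max_(x in K) pos x).+1.
  by move=> xK; rewrite ltnS; apply: leq_bigmax_cond.
split=> [a b aK bK lab _|a b aK bK h _|a b aK bK _ h]; last 2 first.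
- by have := bnd a aK; rewrite ltnNge h.
- by have := bnd b bK; rewrite ltnNge h.
have := tri2 a b aK bK lab; case E: (between c a b) => //= _.
case/negP: nL; apply/existsP; exists a; apply/existsP; exists b.
by rewrite aK bK ltn_neq //= /L lab.
Qed.

(** Old points move to odd positions, which leaves the even value [g.*2] free; it separates the old
    positions below [g] from the others. *)
Lemma ordered_insert K (pos : X -> nat) g c : ordered K pos -> c \notin K ->
  cut K pos g c ->
  ordered (c |: K) (fun x => if x == c then g.*2 else (pos x).*2.+1).
Proof.
move=> [inj ord] cK [lo hi mid].
have neq x : x \in K -> (x == c) = false by move=> xK; apply: contraNF cK => /eqP<-.
split=> [x y|x y z].
  rewrite !inE => /orP[/eqP->|xK] /orP[/eqP->|yK]; rewrite ?eqxx ?neq //; try pos_lia.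
  by move=> e; apply: inj => //; pos_lia.
rewrite !inE => /orP[/eqP->|xK] /orP[/eqP->|yK] /orP[/eqP->|zK]; rewrite ?eqxx ?neq //;
  try pos_lia.
- by move=> l1 l2; apply: hi => //; pos_lia.
- by move=> l1 l2; apply: mid => //; pos_lia.
- by move=> l1 l2; apply: lo => //; pos_lia.
- by move=> l1 l2; apply: ord => //; pos_lia.
Qed.

Lemma orderedS S K (pos : X -> nat) : K \subset S -> ordered S pos -> ordered K pos.
Proof.
move=> /subsetP sKS [inj ord]; split=> [x y xK yK|x y z xK yK zK].
  by apply: inj; apply: sKS.
by apply: ord; apply: sKS.
Qed.

Lemma triangle_freeS S K : K \subset S -> triangle_free S -> triangle_free K.
Proof. by move=> /subsetP sKS h x y z xK yK zK; apply: h; apply: sKS. Qed.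

End Insertion.

Section Line.

Variable B : betweenness.
Local Notation X := (point B).
Implicit Types (x y z w k p q r a b c : X) (S K : {set X}).

Definition ord4 a b c d := [&& between a b c, between b c d,
  between a b d & between a c d].

Ltac fin := repeat match goal with H : is_true (between _ _ _) |- _ => rewrite ?H;
  clear H end; rewrite ?orbT; done.

(* The last alternative is the four-cycle x, y, z, p. *)
Lemma quad_cases x y z p : uniq [:: x; y; z; p] -> between x y z ->
  ~~ noncol p x y -> ~~ noncol p y z -> ~~ noncol p x z ->
  [|| ord4 p x y z, ord4 x p y z, ord4 x y p z, ord4 x y z p |
      [&& between x p z, between p x y & between y z p]].
Proof.
rewrite /= !inE !negb_or => /and4P[/and3P[n1 n2 n3] /andP[n4 n5] n6 _] o.
rewrite /ord4; move=> /colP[h1|h1|h1] /colP[h2|h2|h2] /colP[h3|h3|h3]; saturate; fin.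
Qed.

(** If no four of the five points are linear, [quad_cases] gives a four-cycle each time, and [y],
    [p], [q] sit pairwise opposite each other between [x] and [z], as in the graph K_{2,3}. Then
    [y], [p], [q] cannot be collinear. *)
Lemma exists_ord4 S : triangle_free S -> 4 < #|S| -> exists a b c d,
  [/\ uniq [:: a; b; c; d], all (mem S) [:: a; b; c; d] & ord4 a b c d].
Proof.
move=> fS /card_geqP[s [us ss sS]].
have perm_case x y z p q : uniq [:: x; y; z; p; q] -> all (mem S) [:: x; y; z; p; q] ->
    between x y z -> exists a b c d,
    [/\ uniq [:: a; b; c; d], all (mem S) [:: a; b; c; d] & ord4 a b c d].
  move=> un /=; case/and5P => xS yS zS pS /andP[qS _] o.
  have cS a b c : a \in S -> b \in S -> c \in S -> ~~ noncol a b c by apply: fS.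
  have un1 : uniq [:: x; y; z; p] by move: un; rewrite -[_ :: _]/([:: x; y; z;
    p] ++ [:: q]) cat_uniq => /andP[].
  have un2 : uniq [:: x; y; z; q].
    by apply: subseq_uniq un => /=; rewrite !eqxx; case: ifP => //=; rewrite ?eqxx.
  have un3 : uniq [:: x; p; z; q].
    move: un; rewrite /= !inE !negb_or !andbT.
    by case/and4P=> /and4P[_ -> -> ->] _ /andP[n2 ->] ->; rewrite eq_sym n2.
  have pack a b c d : uniq [:: a; b; c; d] -> a \in S -> b \in S -> c \in S -> d \in S ->
      ord4 a b c d -> exists a b c d,
    [/\ uniq [:: a; b; c; d], all (mem S) [:: a; b; c; d] & ord4 a b c d].
    by move=> *; exists a, b, c, d; split=> //=; apply/and5P.
  have pu a b c d : uniq [:: a; b; c; d] ->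
      [/\ uniq [:: d; a; b; c], uniq [:: a; d; b; c], uniq [:: a; b; d; c] & uniq [:: a;
        b; c; d]].
    rewrite /= !inE !negb_or !andbT (eq_sym d a) (eq_sym d b) (eq_sym d c).
    by case/and3P=> /and3P[-> -> ->] /andP[-> ->] ->.
  have quad b d : b \in S -> d \in S -> uniq [:: x; b; z; d] -> between x b z ->
    (exists a b c d, [/\ uniq [:: a; b; c; d], all (mem S) [:: a; b; c;
      d] & ord4 a b c d])
    \/ [/\ between x d z, between d x b & between b z d].
    move=> bS dS u o'.
    have [u1 u2 u3 u4] := pu _ _ _ _ u.
    have := quad_cases u o' (cS _ _ _ dS xS bS) (cS _ _ _ dS bS zS) (cS _ _ _ dS xS zS).
    by case/or4P => [h|h|h|/orP[h|/and3P[]]]; [left|left|left|left|right => //];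
      apply: pack h.
  case: (quad y p yS pS un1 o) => [//|[a1 a2 a3]].
  case: (quad y q yS qS un2 o) => [//|[b1 b2 b3]].
  case: (quad p q pS qS un3 a1) => [//|[c1 c2 c3]].
  exfalso; move: un; rewrite /= !inE !negb_or !andbT.
  case/and4P=> /and4P[? ? ? ?] /and3P[? ? ?] /andP[? ?] ?.
  case/colP: (cS _ _ _ pS qS yS) => h; saturate.
case: s us ss sS => [|x [|y [|z [|p [|q [|? ?]]]]]] // us _ sS.
have aS : all (mem S) [:: x; y; z; p; q] by apply/allP => w /sS.
have : ~~ noncol x y z by apply: fS; apply: sS; rewrite !inE eqxx ?orbT.
case/colP=> h; [apply: (perm_case x y z p q)|apply: (perm_case y z x p q)|apply:
  (perm_case z x y p q)] => //.
- by rewrite -(perm_uniq (s1 := [:: x; y; z; p; q])) //= -[_ :: _]/([:: x] ++ [:: y;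
  z] ++ [:: p; q]) perm_catCA.
- by move: aS => /= /and5P[-> -> -> -> ->].
- by rewrite -(perm_uniq (s1 := [:: x; y; z; p; q])) //= -[_ :: _]/([:: x;
  y] ++ [:: z] ++ [:: p; q]) perm_catCA.
- by move: aS => /= /and5P[-> -> -> -> ->].
Qed.

Lemma ord4_ordered a b c d : uniq [:: a; b; c; d] -> ord4 a b c d ->
  ordered [set x in [:: a; b; c; d]] (index^~ [:: a; b; c; d]).
Proof.
move=> un /and4P[o1 o2 o3 o4]; split=> [x y|x y z].
  rewrite !in_set => hx hy. exact: index_inj.
rewrite !inE.
move: un; rewrite /= !inE !negb_or !andbT.
case/and3P=> /and3P[/negPf n1 /negPf n2 /negPf n3] /andP[/negPf n4 /negPf n5] /negPf n6.
do 3!case/or4P => /eqP->; by rewrite ?eqxx ?n1 ?n2 ?n3 ?n4 ?n5 ?n6.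
Qed.

(** Four linear points are a start large enough for [cut_exists]; the other points of [S] are
    inserted one by one. *)
Lemma triangle_free_ordered S : triangle_free S -> 4 < #|S| -> exists pos, ordered S pos.
Proof.
move=> fS hS; have [a [b [c [d [u aS o]]]]] := exists_ord4 fS hS.
have := ord4_ordered u o; set K0 := [set x in _]; move: (index^~ _) => pos0 ord0.
have K0S : K0 \subset S by apply/subsetP => x; rewrite inE => /(allP aS).
have cK0 : #|K0| = 4 by rewrite cardsE (card_uniqP u).
suff grow n K pos : K \subset S -> 3 < #|K| -> ordered K pos -> #|S :\: K| <= n ->
    exists pos', ordered S pos'.
  by apply: (grow #|S :\: K0| K0 pos0) => //; rewrite cK0.
elim: n K pos => [|n IH] K pos KS hK ordK.
  rewrite leqn0 cards_eq0 setD_eq0 => SK; exists pos.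
  by have /eqP -> : S == K by rewrite eqEsubset SK.
have [/eqP|[x]] := set_0Vmem (S :\: K).
  rewrite setD_eq0 => SK _; exists pos.
  by have /eqP -> : S == K by rewrite eqEsubset SK.
move=> xD; have := xD; rewrite inE => /andP[xK xS] hn.
have [|g hg] := cut_exists ordK hK _ xK.
  by move=> y z yK zK; apply: fS => //; apply: (subsetP KS).
apply: (IH (x |: K) _ _ _ (ordered_insert ordK xK hg)).
- by rewrite subUset sub1set xS.
- by rewrite cardsU1 xK; lia.
- have -> : S :\: (x |: K) = (S :\: K) :\ x.
    by apply/setP => y; rewrite !inE negb_or andbA.
  by move: hn; rewrite (cardsD1 x (S :\: K)) xD; lia.
Qed.

End Line.

(** * Counting triangles *)

Section Counting.

Variable B : betweenness.
Local Notation X := (point B).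
Implicit Types (x y z w k p q r a b c : X) (S K : {set X}).

Definition pair_deg S a b := \sum_(k in S) (noncol a b k : nat).
(** The two other points are counted in both orders, so each triangle through [x] contributes 2. *)
Definition link_deg S x := \sum_(y in S) pair_deg S x y.
Definition triple_sum S := \sum_(x in S) link_deg S x.
Definition tri_num S := #|[set A in triangles B | A \subset S]|.

Lemma collinearE x y z : uniq [:: x; y; z] -> collinear [set x; y; z] = ~~ noncol x y z.
Proof.
rewrite /= !inE !negb_or !andbT => /andP[/andP[nxy nxz] nyz].
apply/idP/idP.
  case/existsP => a /existsP[b /existsP[c /andP[/eqP/setP e o]]].
  have hn : noncol a b c = false by apply: between_noncol.
  have ea := e a; have eb := e b; have ec := e c.
  have ex := e x; have ey := e y; have ez := e z.
  move: ea eb ec; rewrite !inE !eqxx ?orbT => /orP[/orP[]|]/eqP ea;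
    move => /orP[/orP[]|]/eqP eb; move => /orP[/orP[]|]/eqP ec;
    move: ex ey ez hn; rewrite ea eb ec !inE !eqxx ?(negPf nxy) ?(negPf nxz) ?(negPf nyz)
     ?(eq_sym y x) ?(eq_sym z x) ?(eq_sym z y) ?(negPf nxy) ?(negPf nxz) ?(negPf nyz) //=
       => _ _ _.
  - by move=> ->.
  - by rewrite noncol_swapr => ->.
  - by rewrite noncol_swap => ->.
  - by rewrite -noncol_rot => ->.
  - by rewrite noncol_rot => ->.
  - by rewrite noncol_swap -noncol_rot => ->.
case/colP => h; apply/existsP; [exists x|exists y|exists z]; apply/existsP;
  [exists y|exists z|exists x]; apply/existsP; [exists z|exists x|exists y];
  rewrite -?/(between _ _ _) h andbT //; apply/eqP/setP => w; rewrite !inE;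
  by do 3!case: (w == _).
Qed.

Lemma card3E x y z : uniq [:: x; y; z] -> #|[set x; y; z]| = 3.
Proof.
move=> /= ; rewrite !inE !negb_or !andbT => /andP[/andP[n1 n2] n3].
by rewrite -setUA cardsU1 cards2 !inE negb_or n1 n2 n3.
Qed.

Lemma cards3P (A : {set X}) : #|A| = 3 ->
  exists x y z, uniq [:: x; y; z] /\ A = [set x; y; z].
Proof.
move=> cA; have : uniq (enum A) by apply: enum_uniq.
have : size (enum A) = 3 by rewrite -cardE.
have : enum A =i A by move=> x; rewrite mem_enum.
case: (enum A) => [|x [|y [|z [|]]]] // e _ u; exists x, y, z; split=> //.
by apply/setP => w; rewrite -e !inE orbA.
Qed.

Lemma noncol_uniq x y z : noncol x y z -> uniq [:: x; y; z].
Proof.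
move=> h /=; rewrite !inE !negb_or !andbT.
apply/andP; split; [apply/andP; split|]; apply: contraTneq h => ->;
  by rewrite ?noncol_xx ?noncol_xyx ?noncol_xyy.
Qed.

(* Ordered triples make the sums easy to manipulate; each triangle is counted
   once for each of its 6 orderings. *)
Lemma triple_sumE S : triple_sum S = 6 * tri_num S.
Proof.
pose f (u : X * X * X) := [set u.1.1; u.1.2; u.2].
pose P (u : X * X * X) := [&& u.1.1 \in S, u.1.2 \in S,
  u.2 \in S & noncol u.1.1 u.1.2 u.2].
transitivity (\sum_(u | P u) 1).
  rewrite /triple_sum /link_deg /pair_deg (eq_bigr (fun x =>
    \sum_(y in S) \sum_(z in S | noncol x y z) 1)); last first.
    by move=> x _; apply: eq_bigr => y _; rewrite big_mkcondr.
  under eq_bigr => x _ do rewrite pair_big_dep.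
  rewrite pair_big_dep /= (reindex (fun u : X * X * X => (u.1.1, (u.1.2, u.2)))) /=;
    last first.
    by exists (fun u => (u.1, u.2.1, u.2.2)) => [[[]]|[? []]].
  by apply: eq_bigl => -[[x y] z].
rewrite (partition_big f (mem [set A in triangles B | A \subset S])); last first.
  move=> [[x y] z] /and4P[/= xS yS zS n]; rewrite !inE.
  have u := noncol_uniq n; rewrite /f /= collinearE // card3E // negbK n /=.
  by rewrite !subUset !sub1set xS yS zS.
suff six A : A \in [set A in triangles B | A \subset S] ->
  \sum_(u | P u && (f u == A)) 1 = 6.
  by rewrite (eq_bigr _ six) sum_nat_const mulnC.
rewrite !inE => /andP[/andP[/eqP/cards3P[a [b [c [u ->]]]]]].
rewrite (collinearE u) negbK => n; rewrite !subUset !sub1set => /andP[/andP[aS bS] cS].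
rewrite sum1_card -[6]/(size [:: (a,b,c);(a,c,b);(b,a,c);(b,c,a);(c,a,b);(c,b,a)]).
have uu : uniq [:: (a,b,c);(a,c,b);(b,a,c);(b,c,a);(c,a,b);(c,b,a)].
  move: u; rewrite /= !inE !xpair_eqE !negb_or !andbT => /andP[/andP[nab nac] nbc].
  by rewrite ?eqxx /= ?(eq_sym b a) ?(eq_sym c a) ?(eq_sym c b) ?(negPf nab) ?(negPf nac)
    ?(negPf nbc).
rewrite -(card_uniqP uu); apply: eq_card => -[[x y] z]; rewrite !inE /P /f /= !xpair_eqE.
apply/idP/idP.
  case/andP=> /and4P[_ _ _ n'] /eqP/setP e.
  have := e x; have := e y; have := e z; rewrite !inE !eqxx ?orbT.
  move=> /esym/orP[/orP[]|] /eqP ez /esym/orP[/orP[]|] /eqP ey /esym/orP[/orP[]|] /eqP ex;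
   move: n'; rewrite ex ey ez ?noncol_xx ?noncol_xyx ?noncol_xyy ?eqxx ?orbT //.
have n1 : noncol a c b by rewrite noncol_swapr.
have n2 : noncol b a c by rewrite noncol_swap.
have n3 : noncol b c a by rewrite -noncol_rot.
have n4 : noncol c a b by rewrite noncol_rot.
have n5 : noncol c b a by rewrite noncol_swap.
case/or4P=> [||| /or3P[]] /andP[/andP[/eqP-> /eqP->] /eqP->];
  rewrite -topredE /= aS bS cS ?n ?n1 ?n2 ?n3 ?n4 ?n5 /=; apply/eqP/setP => w;
    rewrite !inE;
  by do 3!case: (w == _).
Qed.

Lemma pair_degU1 S k a b : k \notin S ->
  pair_deg (k |: S) a b = noncol a b k + pair_deg S a b.
Proof. by move=> kS; rewrite /pair_deg big_setU1. Qed.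

Lemma pair_degC S a b : pair_deg S a b = pair_deg S b a.
Proof. by apply: eq_bigr => k _; rewrite noncol_swap. Qed.

Lemma link_degU1 S y x : y \notin S ->
  link_deg (y |: S) x = link_deg S x + 2 * pair_deg S x y.
Proof.
move=> yS; rewrite /link_deg big_setU1 //= pair_degU1 // noncol_xyy add0n.
rewrite (eq_bigr (fun z => noncol x y z + pair_deg S x z)); last first.
  by move=> z _; rewrite pair_degU1 // noncol_swapr.
rewrite big_split /= -/(pair_deg S x y); lia.
Qed.

(** The factor 3 is the number of places [x] can take in an ordered triple; triples with [x] twice
    contribute nothing. *)
Lemma triple_sumU1 S x : x \notin S ->
  triple_sum (x |: S) = triple_sum S + 3 * link_deg S x.
Proof.
move=> xS; rewrite /triple_sum big_setU1 //= link_degU1 // /pair_deg big1 => [|k _];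
  last by rewrite noncol_xx.
rewrite (eq_bigr (fun y => link_deg S y + 2 * pair_deg S x y)); last first.
  by move=> y yS; rewrite link_degU1 // pair_degC.
by rewrite big_split /= -big_distrr /= -/(link_deg S x); lia.
Qed.

Lemma triple_sum_eq0 S : (triple_sum S == 0) <-> triangle_free S.
Proof.
rewrite /triple_sum sum_nat_eq0; split.
  move=> /forall_inP h x y z xS yS zS; have := h x xS.
  rewrite sum_nat_eq0 => /forall_inP/(_ y yS); rewrite sum_nat_eq0 =>
    /forall_inP/(_ z zS).
  by case: noncol.
move=> h; apply/forall_inP => x xS; rewrite sum_nat_eq0; apply/forall_inP => y yS.
by rewrite sum_nat_eq0; apply/forall_inP => z zS; rewrite (negPf (h _ _ _ _ _ _)).
Qed.

Lemma tri_num_eq0 S : tri_num S = 0 <-> triangle_free S.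
Proof. by rewrite -triple_sum_eq0 triple_sumE; case: (tri_num S). Qed.

Lemma pair_deg_le S a b : pair_deg S a b <= #|S|.
Proof. by rewrite /pair_deg -sum1_card; apply: leq_sum => k _; case: noncol. Qed.

Lemma triangle_free_pair_deg S (T : {set X}) a b : triangle_free S -> T \subset S ->
  a \in S -> b \in S -> pair_deg T a b = 0.
Proof.
move=> h /subsetP TS aS bS; apply: big1 => k kT.
by rewrite (negPf (h _ _ _ _ _ _)) // TS.
Qed.

Lemma triangle_free_link_deg S (T : {set X}) a : triangle_free S -> T \subset S ->
  a \in S -> link_deg T a = 0.
Proof.
by move=> h TS aS; apply: big1 => b bT; apply: (triangle_free_pair_deg h) => //;
  apply: (subsetP TS).
Qed.

End Counting.

Ltac noncol_auto := saturate; rewrite /noncol ?negbK;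
  repeat match goal with H : is_true (between _ _ _) |- _ => rewrite ?H; clear H end;
  rewrite ?orbT; done.

(** * Two and three points entering an ordered set *)

Section Pair.

Variable B : betweenness.
Local Notation X := (point B).
Implicit Types (x y z w k p q r a b c : X) (S K : {set X}).

Lemma cut_cases K (pos : X -> nat) g c x y : cut K pos g c -> x \in K -> y \in K ->
  pos x < pos y ->
  [\/ [/\ pos x < g, pos y < g & between x y c], [/\ pos x < g,
    g <= pos y & between x c y]
    | [/\ g <= pos x, g <= pos y & between c x y]].
Proof.
case=> lo hi mid xK yK lxy.
have [lx|lx] := ltnP (pos x) g; have [ly|ly] := ltnP (pos y) g.
- by constructor 1; split=> //; apply: lo.
- by constructor 2; split=> //; apply: mid.
- by exfalso; pos_lia.
- by constructor 3; split=> //; apply: hi.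
Qed.

(* [h] and [g] are the gaps of [c] and [p]; the collinear [k] are the ends of
   the common gap. *)
Definition same_cut K (pos : X -> nat) h g c p :=
  (forall k, k \in K -> (pos k < h) = (pos k < g)) /\
  (forall k, k \in K -> ~~ noncol c p k -> between c k p /\
     ((pos k < h /\ forall x, x \in K -> pos x < h -> pos x <= pos k) \/
      (h <= pos k /\ forall x, x \in K -> h <= pos x -> pos k <= pos x))).

(* [c] precedes all of [K] and [p] follows it. *)
Definition opp_ends K (pos : X -> nat) h g c p :=
  (forall k, k \in K -> h <= pos k /\ pos k < g) /\
  (forall k, k \in K -> ~~ noncol c p k ->
     (between k c p /\ forall x, x \in K -> pos k <= pos x) \/
     (between k p c /\ forall x, x \in K -> pos x <= pos k)).

(** The cases depend on the stretch of [K] between the two gaps: some point of it is between [c] and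
    [p], or it is nonempty without such a point, or it is empty and the gaps coincide. *)
Lemma insert_pair_le K pos h g c p : ordered K pos -> cut K pos h c -> cut K pos g p ->
  c \notin K -> p \notin K -> c != p -> h <= g ->
  [\/ forall k, k \in K -> ~~ noncol c p k,
    same_cut K pos h g c p | opp_ends K pos h g c p].
Proof.
move=> [inj ord] cc cp cK pK ncp hg.
have neq x y : x \in K -> y \notin K -> x != y by move=> xK; apply: contraNneq => <-.
have [/existsP[k0 /and4P[k0K h1 h2 o]]|noD1] :=
  boolP [exists k0, [&& k0 \in K, h <= pos k0, pos k0 < g & between c k0 p]].
  constructor 1 => k kK.
  have n1 := neq _ _ k0K cK; have n2 := neq _ _ k0K pK.
  have n3 := neq _ _ kK cK; have n4 := neq _ _ kK pK.
  case: (ltngtP (pos k) (pos k0)) => lk; last by have -> := inj _ _ kK k0K lk;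
    noncol_auto.
  - by case: (cut_cases cc kK k0K lk) => -[a1 a2 a3];
    case: (cut_cases cp kK k0K lk) => -[b1 b2 b3]; 
      first [exfalso; pos_lia | noncol_auto].
  - by case: (cut_cases cc k0K kK lk) => -[a1 a2 a3];
    case: (cut_cases cp k0K kK lk) => -[b1 b2 b3]; 
      first [exfalso; pos_lia | noncol_auto].
have [/existsP[k0 /and3P[k0K h1 h2]]|noD] :=
  boolP [exists k0, [&& k0 \in K, h <= pos k0 & pos k0 < g]].
  have nD k : k \in K -> h <= pos k -> pos k < g -> ~~ between c k p.
    by move=> kK a1 a2; have := existsPn noD1 k; rewrite kK a1 a2.
  have b0 := nD k0 k0K h1 h2.
  have n1 := neq _ _ k0K cK; have n2 := neq _ _ k0K pK.
  (* A point of [K] outside the stretch would, by (P4), put [k0] between [c] and [p]; so the stretch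
     is all of [K]. *)
  have inD k : k \in K -> h <= pos k /\ pos k < g.
    move=> kK; have n3 := neq _ _ kK cK; have n4 := neq _ _ kK pK.
    apply/andP; apply: contraNT b0; rewrite negb_and -ltnNge -leqNgt => kout.
    case: (ltngtP (pos k) (pos k0)) => lk; last first.
    - by exfalso; have e := inj _ _ kK k0K lk; subst k; case/orP: kout => ?; pos_lia.
    - by case: (cut_cases cc k0K kK lk) => -[a1 a2 a3];
      case: (cut_cases cp k0K kK lk) => -[b1 b2 b3];
        first [exfalso; pos_lia | between_auto].
    - by case: (cut_cases cc kK k0K lk) => -[a1 a2 a3];
      case: (cut_cases cp kK k0K lk) => -[b1 b2 b3];
        first [exfalso; pos_lia | between_auto].
  constructor 3; split=> // k kK.
  have [hk kg] := inD k kK; have n3 := neq _ _ kK cK; have n4 := neq _ _ kK pK.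
  case/colP=> o; last 2 first.
  - by have := nD k kK hk kg; rewrite (between_sym o).
  - left; split=> // x xK; rewrite leqNgt; apply/negP => lx.
    have [? ?] := inD x xK; have n5 := neq _ _ xK cK; have n6 := neq _ _ xK pK.
    have nxk : x != k by apply: contraTneq lx => ->; rewrite ltnn.
    by case: (cut_cases cc xK kK lx) => -[a1 a2 a3]; case: (cut_cases cp xK kK lx) =>
      -[b1 b2 b3];
        first [exfalso; pos_lia | between_auto].
  - right; split; first exact: between_sym.
    move=> x xK; rewrite leqNgt; apply/negP => lx.
    have [? ?] := inD x xK; have n5 := neq _ _ xK cK; have n6 := neq _ _ xK pK.
    have nxk : x != k by apply: contraTneq lx => ->; rewrite ltnn.
    by case: (cut_cases cc kK xK lx) => -[a1 a2 a3]; case: (cut_cases cp kK xK lx) =>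
      -[b1 b2 b3];
        first [exfalso; pos_lia | between_auto].
have same k : k \in K -> (pos k < h) = (pos k < g).
  move=> kK; have := existsPn noD k; rewrite kK /=; case: ltnP; case: ltnP => //; pos_lia.
(* One collinear [k] that is not between [c] and [p] already decides the order of [c] and [p] inside
   the common gap, and then every point of [K] is collinear with them. *)
have [/existsP[k /and3P[kK nk bk]]|allb] :=
  boolP [exists k, [&& k \in K, ~~ noncol c p k & ~~ between c k p]].
  have n1 := neq _ _ kK cK; have n2 := neq _ _ kK pK.
  constructor 1 => x xK; have n3 := neq _ _ xK cK; have n4 := neq _ _ xK pK.
  have sk := same k kK; have sx := same x xK.
  case: (ltngtP (pos x) (pos k)) => lk; last by have -> := inj _ _ xK kK lk.
  - by case: (cut_cases cc xK kK lk) => -[a1 a2 a3]; case: (cut_cases cp xK kK lk) =>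
    -[b1 b2 b3];
      try (exfalso; clear - a1 a2 b1 b2 sk sx; lia);
      case/colP: nk => o; try noncol_auto; rewrite (between_sym o) in bk.
  - by case: (cut_cases cc kK xK lk) => -[a1 a2 a3]; case: (cut_cases cp kK xK lk) =>
    -[b1 b2 b3];
      try (exfalso; clear - a1 a2 b1 b2 sk sx; lia);
      case/colP: nk => o; try noncol_auto; rewrite (between_sym o) in bk.
constructor 2; split=> // k kK nk; have o : between c k p.
  by have := existsPn allb k; rewrite kK nk /= negbK.
split=> //; have n1 := neq _ _ kK cK; have n2 := neq _ _ kK pK.
have sk := same k kK.
have [lk|lk] := ltnP (pos k) h; [left|right]; split=> // x xK lx; rewrite leqNgt;
  apply/negP => l;
  have sx := same x xK; have n3 := neq _ _ xK cK; have n4 := neq _ _ xK pK;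
  have nxk : x != k by [apply: contraTneq l => ->; rewrite ltnn].
- by case: (cut_cases cc kK xK l) => -[a1 a2 a3]; case: (cut_cases cp kK xK l) =>
  -[b1 b2 b3];
    first [exfalso; clear - a1 a2 b1 b2 sk sx lx lk; lia | between_auto].
- by case: (cut_cases cc xK kK l) => -[a1 a2 a3]; case: (cut_cases cp xK kK l) =>
  -[b1 b2 b3];
    first [exfalso; clear - a1 a2 b1 b2 sk sx lx lk; lia | between_auto].
Qed.

Lemma insert_pair_cases K pos h g c p : ordered K pos -> cut K pos h c -> cut K pos g p ->
  c \notin K -> p \notin K -> c != p ->
  [\/ forall k, k \in K -> ~~ noncol c p k, same_cut K pos h g c p,
      opp_ends K pos h g c p | opp_ends K pos g h p c].
Proof.
move=> o cc cp cK pK ncp; have [hg|/ltnW gh] := leqP h g.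
  case: (insert_pair_le o cc cp cK pK ncp hg) => H;
    [by constructor 1|by constructor 2|by constructor 3].
have npc : p != c by rewrite eq_sym.
case: (insert_pair_le o cp cc pK cK npc gh) => H; [|constructor 2|by constructor 4].
  by constructor 1 => k kK; rewrite noncol_swap H.
case: H => s H; split=> [k kK|k kK]; first by rewrite s.
rewrite noncol_swap => n; case: (H k kK n) => hk.
have e := s k kK.
case=> -[l1 l2]; split; try exact: between_sym; [left|right]; (split;
  first (clear - e l1; lia)).
  by move=> x xK lx; apply: l2 => //; rewrite s.
by move=> x xK lx; apply: l2 => //; rewrite leqNgt s // -leqNgt.
Qed.

Lemma triangle_freeU2 K c p : triangle_free (c |: K) -> triangle_free (p |: K) ->
  (forall k, k \in K -> ~~ noncol c p k) -> triangle_free (c |: (p |: K)).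
Proof.
move=> fc fp cp x y z.
have h u v : u \in c |: (p |: K) -> v \in c |: (p |: K) -> ~~ noncol c u v.
  rewrite !inE => /or3P[/eqP->|/eqP->|uK] /or3P[/eqP->|/eqP->|vK];
    rewrite ?noncol_xx ?noncol_xyx ?noncol_xyy //; try by apply: cp.
  - by rewrite noncol_swapr cp.
  - by apply: fc; rewrite ?setU11 // setU1r.
have [->|xc] := eqVneq x c; first by move=> _; apply: h.
have [->|yc] := eqVneq y c; first by move=> hx _ hz; rewrite noncol_swap h.
have [->|zc] := eqVneq z c; first by move=> hx hy _; rewrite -noncol_rot h.
by rewrite !(in_setU1 _ c) (negPf xc) (negPf yc) (negPf zc); apply: fp.
Qed.

End Pair.

(** Used for the points collinear with an inserted pair: [P] and [Q] single out the two ends of a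
    gap or the two ends of [K], and being extreme makes each unique. *)
Lemma two_classes (T : finType) (A : {set T}) (P Q : T -> Prop) :
  (forall x, x \in A -> P x \/ Q x) ->
  (forall x y, x \in A -> y \in A -> P x -> P y -> x = y) ->
  (forall x y, x \in A -> y \in A -> Q x -> Q y -> x = y) ->
  #|A| <= 2 /\ (2 <= #|A| -> exists x y, [/\ x \in A, y \in A, P x & Q y] /\ x != y /\
    forall z, z \in A -> z = x \/ z = y).
Proof.
move=> PQ Pu Qu.
have le3 x y z : x \in A -> y \in A -> z \in A -> x != y -> z = x \/ z = y.
  move=> xA yA zA /eqP n.
  case: (PQ x xA) (PQ y yA) (PQ z zA) => hx [] hy [] hz; try (by case: n; auto);
    try (by left; auto); by right; auto.
split=> [|/card_gt1P[x [y [xA yA n]]]].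
  rewrite leqNgt; apply/negP => /card_gt2P[x [y [z [[xA yA zA] [n1 n2 n3]]]]].
  by case: (le3 x y z xA yA zA n1) => e; move: n2 n3; rewrite e eqxx.
have rest z : z \in A -> z = x \/ z = y by move=> zA; apply: le3.
case: (PQ x xA) (PQ y yA) => hx [] hy.
- by case/eqP: n; apply: Pu.
- by exists x, y.
- exists y, x; split=> //; split; first by rewrite eq_sym.
  by move=> z /rest[]; [right|left].
- by case/eqP: n; apply: Qu.
Qed.

Section PairCount.

Variable B : betweenness.
Local Notation X := (point B).
Implicit Types (x y z w k p q r a b c : X) (S K : {set X}).

(** The tight form of [same_cut]: the gap is inner, and both its ends [k1], [k2] complete a
    four-cycle with [c] and [p]. *)
Definition same_gap K (pos : X -> nat) h g c p :=
  (forall k, k \in K -> (pos k < h) = (pos k < g)) /\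
  exists k1 k2, [/\ k1 \in K, k2 \in K, pos k1 < h & h <= pos k2] /\
   [/\ forall x, x \in K -> pos x < h -> pos x <= pos k1,
       forall x, x \in K -> h <= pos x -> pos k2 <= pos x,
       between c k1 p, between c k2 p & forall k, k \in K -> ~~ noncol c p k ->
         k = k1 \/ k = k2].

(** The tight form of [opp_ends]: the two collinear points are the first and the last point of
    [K]. *)
Definition opposite K (pos : X -> nat) h g c p :=
  (forall k, k \in K -> h <= pos k /\ pos k < g) /\
  exists k1 k2, [/\ k1 \in K, k2 \in K & k1 != k2] /\
   [/\ forall x, x \in K -> pos k1 <= pos x,
       forall x, x \in K -> pos x <= pos k2,
       between k1 c p, between k2 p c & forall k, k \in K -> ~~ noncol c p k ->
         k = k1 \/ k = k2].

Lemma col_card K c p : #|[set k in K | ~~ noncol c p k]| + pair_deg K c p = #|K|.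
Proof.
rewrite /pair_deg -!sum1_card [RHS](bigID (fun k => ~~ noncol c p k)) /=; congr (_ + _).
  by apply: eq_bigl => k; rewrite !inE.
by rewrite big_mkcondr /=; apply: eq_bigr => k _; rewrite negbK; case: noncol.
Qed.

Lemma insert_pair_struct K pos h g c p : ordered K pos -> cut K pos h c ->
  cut K pos g p ->
  c \notin K -> p \notin K -> c != p ->
  pair_deg K c p = 0 \/
  #|K| <= pair_deg K c p + 2 /\
  (pair_deg K c p + 2 <= #|K| -> [\/ same_gap K pos h g c p, opposite K pos h g c p
     | opposite K pos g h p c]).
Proof.
move=> o cc cp cK pK ncp; have [inj _] := o.
have := col_card K c p; set A := [set k in K | _] => cA.
have AP k : k \in A -> k \in K /\ ~~ noncol c p k by rewrite inE => /andP.
have PA k : k \in K -> ~~ noncol c p k -> k \in A by rewrite inE => -> ->.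
have ends h' g' c' p' : (forall k, ~~ noncol c p k = ~~ noncol c' p' k) ->
  opp_ends K pos h' g' c' p' ->
  #|A| <= 2 /\ (2 <= #|A| -> opposite K pos h' g' c' p').
  move=> e [hD H].
  have [] := @two_classes _ A (fun k => between k c' p' /\ forall x, x \in K ->
    pos k <= pos x)
     (fun k => between k p' c' /\ forall x, x \in K -> pos x <= pos k).
  - by move=> k /AP[kK]; rewrite e; apply: H.
  - move=> x y /AP[xK _] /AP[yK _] [_ hx] [_ hy]; apply: inj => //; apply/eqP.
    by rewrite eqn_leq hx ?hy.
  - move=> x y /AP[xK _] /AP[yK _] [_ hx] [_ hy]; apply: inj => //; apply/eqP.
    by rewrite eqn_leq hx ?hy.
  move=> le2 H2; split=> // /H2[k1 [k2 [[/AP[k1K n1] /AP[k2K n2] [b1 m1] [b2 m2]] [n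
    rest]]]].
  split=> //; exists k1, k2; split=> //; split=> // k kK nk; apply: rest.
  by apply: PA => //; rewrite e.
have done' (P : Prop) : #|A| <= 2 /\ (2 <= #|A| -> P) -> #|K| <= pair_deg K c p + 2 /\
  (pair_deg K c p + 2 <= #|K| -> P).
  by case=> h1 h2; split=> [|?]; [|apply: h2]; lia.
case: (insert_pair_cases o cc cp cK pK ncp) => H.
- by left; apply: big1 => k kK; rewrite (negPf (H k kK)).
- right; apply: done'.
  have [] := @two_classes _ A (fun k => [/\ between c k p, pos k < h & forall x,
    x \in K -> pos x < h -> pos x <= pos k])
     (fun k => [/\ between c k p, h <= pos k & forall x, x \in K -> h <= pos x ->
       pos k <= pos x]).
  - by move=> k /AP[kK nk]; case: H => _ /(_ k kK nk)[b [[? ?]|[? ?]]]; [left|right].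
  - move=> x y /AP[xK _] /AP[yK _] [_ lx hx] [_ ly hy]; apply: inj => //; apply/eqP.
    by rewrite eqn_leq hx ?hy.
  - move=> x y /AP[xK _] /AP[yK _] [_ lx hx] [_ ly hy]; apply: inj => //; apply/eqP.
    by rewrite eqn_leq hx ?hy.
  move=> le2 H2; split=> // /H2[k1 [k2 [[/AP[k1K n1] /AP[k2K n2] [b1 l1 m1] [b2 l2 m2]]
    [n rest]]]].
  constructor 1; split; first by case: H.
  exists k1, k2; split=> //; split=> // k kK nk; apply: rest; exact: PA.
- right; apply: done'; have [a1 a2] := ends _ _ _ _ (fun=> erefl) H.
  by split=> // /a2; constructor 2.
- right; apply: done'; have [a1 a2] := ends _ _ _ _ (fun k =>
  congr1 negb (noncol_swap c p k)) H.
  by split=> // /a2; constructor 3.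
Qed.

Lemma triangle_free_cut K pos c : ordered K pos -> 3 < #|K| ->
  triangle_free (c |: K) -> c \notin K ->
  exists g, cut K pos g c.
Proof.
move=> o hK fc cK; apply: (cut_exists o) => // x y xK yK.
by apply: fc; rewrite ?setU11 // setU1r.
Qed.

Lemma ordered_cut S (pos : X -> nat) c : ordered S pos -> c \in S ->
  cut (S :\ c) pos (pos c) c.
Proof.
move=> [inj ord] cS; split=> x y; rewrite !inE => /andP[xc xS] /andP[yc yS] l1 l2.
- exact: ord.
- apply: ord => //; move: l1; rewrite leq_eqVlt => /orP[/eqP/inj e|//].
  by move: xc; rewrite -e ?eqxx.
- apply: ord => //; move: l2; rewrite leq_eqVlt => /orP[/eqP/inj e|//].
  by move: yc; rewrite -e ?eqxx.
Qed.

Lemma triangle_free_extension K c : triangle_free (c |: K) -> c \notin K -> 3 < #|K| ->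
  exists pos, ordered (c |: K) pos /\ ordered K pos /\ cut K pos (pos c) c.
Proof.
move=> fc cK hK; have [|pos o] := triangle_free_ordered fc; first by rewrite cardsU1 cK.
exists pos; split=> //; split; first by apply: (orderedS _ o); apply: subsetUr.
by have := ordered_cut o (setU11 c K); rewrite setU1K.
Qed.

Lemma insert_pair_count K c p : 3 < #|K| -> triangle_free (c |: K) ->
  triangle_free (p |: K) ->
  c \notin K -> p \notin K -> c != p -> pair_deg K c p = 0 \/ #|K| <= pair_deg K c p + 2.
Proof.
move=> hK fc fp cK pK ncp.
have [pos [_ [o cc]]] := triangle_free_extension fc cK hK.
have [g cp] := triangle_free_cut o hK fp pK.
by case: (insert_pair_struct o cc cp cK pK ncp) => [|[]]; [left|right].
Qed.

End PairCount.

Section Three.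

Variable B : betweenness.
Local Notation X := (point B).
Implicit Types (x y z w k p q r a b c : X) (S K : {set X}).

Lemma pair_deg0_noncol K c p : pair_deg K c p = 0 -> forall k, k \in K -> ~~ noncol c p k.
Proof.
move=> /eqP; rewrite sum_nat_eq0 => /forall_inP h k kK.
by have := h k kK; case: noncol.
Qed.

Lemma cut_ordered_in S K (pos : X -> nat) c : ordered S pos -> c \in S -> c \notin K ->
  K \subset S -> cut K pos (pos c) c.
Proof.
move=> o cS cK KS; have := ordered_cut (orderedS (_ : c |: K \subset S) o) (setU11 c K).
by rewrite setU1K //; apply; rewrite subUset sub1set cS.
Qed.

(* [a] and [b] share the gap of [c] or lie beyond the end of [K] opposite to
   [c]; in both cases no point of the triple [a], [b], [c] can be the middle
   one. *)
Lemma three_insertions_tight K a b c : 3 < #|K| -> a \notin K -> b \notin K ->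
  c \notin K ->
  a != b -> c != a -> c != b ->
  triangle_free (a |: K) -> triangle_free (b |: K) -> triangle_free (c |: K) ->
  pair_deg K c a + 2 = #|K| -> pair_deg K c b + 2 = #|K| -> pair_deg K a b = 0 ->
    ~~ noncol a b c -> False.
Proof.
move=> hK aK bK cK nab nca ncb fa fb fc ta tb tab nabc.
have fS := triangle_freeU2 fa fb (pair_deg0_noncol tab).
have cS : 4 < #|a |: (b |: K)|.
  by rewrite !cardsU1 in_setU1 negb_or nab aK bK; pos_lia.
have [pos o] := triangle_free_ordered fS cS; have [inj ord] := o.
have KS : K \subset a |: (b |: K) by rewrite setUA subsetUr.
have aS : a \in a |: (b |: K) by apply: setU11.
have bS : b \in a |: (b |: K) by rewrite setU1r ?setU11.
have oK := orderedS KS o.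
have ca := cut_ordered_in o aS aK KS.
have cb := cut_ordered_in o bS bK KS.
have [g cc] := triangle_free_cut oK hK fc cK.
have xS x : x \in K -> x \in a |: (b |: K) by apply: (subsetP KS).
have sa := insert_pair_struct oK cc ca cK aK nca.
have sb := insert_pair_struct oK cc cb cK bK ncb.
case: sa => [|[_ sa]]; first by pos_lia.
case: sb => [|[_ sb]]; first by pos_lia.
have {}sa := sa ltac:(pos_lia); have {}sb := sb ltac:(pos_lia).
have nin x y : x \in K -> y \notin K -> x != y by move=> xK; apply: contraNneq => <-.
have lts x y : x \in a |: (b |: K) -> y \in a |: (b |: K) -> x != y ->
  pos x < pos y \/ pos y < pos x.
  move=> hx hy n; case: (ltngtP (pos x) (pos y)) => e; [by left|by right|].
  by move: n; rewrite (inj x y hx hy e) eqxx.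
have uniq_by x y : x \in K -> y \in K -> pos x <= pos y -> pos y <= pos x -> x = y.
  by move=> xK yK l1 l2; apply: inj; [apply: xS|apply: xS|apply/eqP; rewrite eqn_leq l1].
(* Both structures speak of the same gap [g] of [c], which is inner, before [K] or after [K]. So the
   mixed cases vanish, and in the three others the extreme points of both structures coincide. *)
case: sa => [[sa1 [k1 [k2 [[k1K k2K l1 l2] [m1 m2 b1 b2 _]]]]]|[sa1 [k1 [k2 [[k1K k2K nk]
  [m1 m2 b1 b2 _]]]]]|[sa1 [k1 [k2 [[k1K k2K nk] [m1 m2 b1 b2 _]]]]]];
case: sb => [[sb1 [j1 [j2 [[j1K j2K lj1 lj2] [n1 n2 d1 d2 _]]]]]|[sb1 [j1 [j2 [[j1K j2K
  nj] [n1 n2 d1 d2 _]]]]]|[sb1 [j1 [j2 [[j1K j2K nj] [n1 n2 d1 d2 _]]]]]];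
try (by case: (sa1 _ k1K) => ? ?; case: (sb1 _ k1K) => ? ?; pos_lia);
try (by case: (sb1 _ k1K) => ? ?; pos_lia); try (by case: (sb1 _ k2K) => ? ?; pos_lia);
try (by case: (sa1 _ j1K) => ? ?; pos_lia); try (by case: (sa1 _ j2K) => ? ?; pos_lia);
 have e1 : k1 = j1 by [apply: uniq_by; auto];
 have e2 : k2 = j2 by [apply: uniq_by; auto]; subst j1 j2.
- have a1 : pos k1 < pos a by rewrite -sa1.
  have a2 : pos k1 < pos b by rewrite -sb1.
  have a3 : pos a < pos k2.
    case: (lts k2 a (xS _ k2K) aS (nin _ _ k2K aK)) => //; rewrite -sa1 //; pos_lia.
  have a4 : pos b < pos k2.
    case: (lts k2 b (xS _ k2K) bS (nin _ _ k2K bK)) => //; rewrite -sb1 //; pos_lia.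
  have n1a := nin _ _ k1K aK; have n2a := nin _ _ k2K aK.
  have n1b := nin _ _ k1K bK; have n2b := nin _ _ k2K bK.
  have n1c := nin _ _ k1K cK; have n2c := nin _ _ k2K cK.
  have o1 := ord _ _ _ (xS _ k1K) aS (xS _ k2K) a1 a3.
  have o2 := ord _ _ _ (xS _ k1K) bS (xS _ k2K) a2 a4.
  case: (lts a b aS bS nab) => l.
    have o3 := ord _ _ _ (xS _ k1K) aS bS a1 l.
    have o4 := ord _ _ _ aS bS (xS _ k2K) l a4.
    by case/colP: nabc => o'; between_auto.
  have o3 := ord _ _ _ (xS _ k1K) bS aS a2 l.
  have o4 := ord _ _ _ bS aS (xS _ k2K) l a3.
  by case/colP: nabc => o'; between_auto.
- have n1a := nin _ _ k1K aK; have n2a := nin _ _ k2K aK.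
  have n1b := nin _ _ k1K bK; have n2b := nin _ _ k2K bK.
  have n1c := nin _ _ k1K cK; have n2c := nin _ _ k2K cK.
  have [_ a1] := sa1 _ k1K; have [_ a2] := sa1 _ k2K.
  have [_ a3] := sb1 _ k1K; have [_ a4] := sb1 _ k2K.
  have l12 : pos k1 < pos k2.
    by case: (lts _ _ (xS _ k1K) (xS _ k2K) nk) => // l; have := m1 _ k2K; pos_lia.
  have o1 := ord _ _ _ (xS _ k1K) (xS _ k2K) aS l12 a2.
  have o2 := ord _ _ _ (xS _ k1K) (xS _ k2K) bS l12 a4.
  case: (lts a b aS bS nab) => l.
    have o3 := ord _ _ _ (xS _ k1K) aS bS a1 l.
    have o4 := ord _ _ _ (xS _ k2K) aS bS a2 l.
    by case/colP: nabc => o'; between_auto.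
  have o3 := ord _ _ _ (xS _ k1K) bS aS a3 l.
  have o4 := ord _ _ _ (xS _ k2K) bS aS a4 l.
  by case/colP: nabc => o'; between_auto.
- have n1a := nin _ _ k1K aK; have n2a := nin _ _ k2K aK.
  have n1b := nin _ _ k1K bK; have n2b := nin _ _ k2K bK.
  have n1c := nin _ _ k1K cK; have n2c := nin _ _ k2K cK.
  have lo x : x \in K -> pos a < pos x.
    move=> xK; case: (lts _ _ (xS _ xK) aS (nin _ _ xK aK)) => // l.
    by have [l' _] := sa1 _ xK; pos_lia.
  have lo' x : x \in K -> pos b < pos x.
    move=> xK; case: (lts _ _ (xS _ xK) bS (nin _ _ xK bK)) => // l.
    by have [l' _] := sb1 _ xK; pos_lia.
  have a1 := lo _ k1K; have a2 := lo _ k2K; have a3 := lo' _ k1K; have a4 := lo' _ k2K.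
  have l12 : pos k1 < pos k2.
    by case: (lts _ _ (xS _ k1K) (xS _ k2K) nk) => // l; have := m1 _ k2K; pos_lia.
  have o1 := ord _ _ _ aS (xS _ k1K) (xS _ k2K) a1 l12.
  have o2 := ord _ _ _ bS (xS _ k1K) (xS _ k2K) a3 l12.
  case: (lts a b aS bS nab) => l.
    have o3 := ord _ _ _ aS bS (xS _ k1K) l a3.
    have o4 := ord _ _ _ aS bS (xS _ k2K) l a4.
    by case/colP: nabc => o'; between_auto.
  have o3 := ord _ _ _ bS aS (xS _ k1K) l a1.
  have o4 := ord _ _ _ bS aS (xS _ k2K) l a2.
  by case/colP: nabc => o'; between_auto.
Qed.

(* All triangles of [S] contain both [c] and [p]. *)
Definition shared S := exists c p,
  [/\ c \in S, p \in S, c != p, triangle_free (S :\ c) & triangle_free (S :\ p)].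

(** A triangle with two points in [K] would lie in [K] plus one point, which has none; so every
    triangle contains at least two of [p], [q], [r]. *)
Lemma tri_numU3 K p q r : p \notin K -> q \notin K -> r \notin K -> p != q -> p != r ->
  q != r ->
  triangle_free (p |: K) -> triangle_free (q |: K) -> triangle_free (r |: K) ->
  tri_num (p |: (q |: (r |: K))) = pair_deg K p q + pair_deg K p r + pair_deg K q r +
    noncol p q r.
Proof.
move=> pK qK rK npq npr nqr fp fq fr.
have fK := triangle_freeS (subsetUr _ _) fp.
have qr : q \notin r |: K by rewrite in_setU1 negb_or nqr.
have pqr : p \notin q |: (r |: K) by rewrite !in_setU1 !negb_or npq npr.
apply/eqP; rewrite -(eqn_pmul2l (isT : 0 < 6)) -triple_sumE !triple_sumU1 // !link_degU1
  // pair_degU1 //.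
have -> : triple_sum K = 0 by apply/eqP/triple_sum_eq0.
rewrite (triangle_free_link_deg fp (subsetUr _ _) (setU11 _ _)) (triangle_free_link_deg
  fq (subsetUr _ _) (setU11 _ _)).
rewrite (triangle_free_link_deg fr (subsetUr _ _) (setU11 _ _)).
by apply/eqP; pos_lia.
Qed.

(** Each pair count is 0 or at least [#|K| - 2]. Three nonzero counts exceed the bound; two nonzero
    ones are tight, with nothing else left, and [three_insertions_tight] excludes this; with at most
    one, that pair is the shared one. *)
Lemma three_insertions_setU K p q r : 3 < #|K| ->
  p \notin K -> q \notin K -> r \notin K -> p != q -> p != r -> q != r ->
  triangle_free (p |: K) -> triangle_free (q |: K) -> triangle_free (r |: K) ->
  tri_num (p |: (q |: (r |: K))) <= 2 * #|K| - 4 -> shared (p |: (q |: (r |: K))).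
Proof.
move=> hK pK qK rK npq npr nqr fp fq fr.
rewrite tri_numU3 // => hm.
have two a b c : a \notin K -> b \notin K -> c \notin K -> a != b -> a != c -> b != c ->
    triangle_free (a |: K) -> triangle_free (b |: K) -> triangle_free (c |: K) ->
    pair_deg K a b = 0 -> pair_deg K a c = 0 -> shared (a |: (b |: (c |: K))).
  move=> aK bK cK nab nac nbc fa fb fc t1 t2; exists b, c; split=> //.
  - by rewrite !inE eqxx orbT.
  - by rewrite !inE eqxx !orbT.
  - apply: triangle_freeS (triangle_freeU2 fa fc (pair_deg0_noncol t2)).
    by apply/subsetP => x; rewrite !inE => /andP[/negPf->].
  - apply: triangle_freeS (triangle_freeU2 fa fb (pair_deg0_noncol t1)).
    by apply/subsetP => x; rewrite !inE => /andP[/negPf->].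
have c1 := insert_pair_count hK fp fq pK qK npq.
have c2 := insert_pair_count hK fp fr pK rK npr.
have c3 := insert_pair_count hK fq fr qK rK nqr.
have contra a b c : a \notin K -> b \notin K -> c \notin K -> a != b -> c != a ->
  c != b ->
    triangle_free (a |: K) -> triangle_free (b |: K) -> triangle_free (c |: K) ->
    #|K| <= pair_deg K c a + 2 -> #|K| <= pair_deg K c b + 2 ->
    pair_deg K c a + pair_deg K c b + pair_deg K a b + noncol a b c <= 2 * #|K| - 4 ->
    pair_deg K a b = 0 -> False.
  move=> aK bK cK nab nca ncb fa fb fc h1 h2 h3 h4.
  have h5 : ~~ noncol a b c by move: h3; case: noncol => //; pos_lia.
  by apply: (three_insertions_tight hK aK bK cK nab nca ncb fa fb fc) => //; pos_lia.
case: c1 => c1; case: c2 => c2.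
- exact: two.
- case: c3 => c3.
    have -> : p |: (q |: (r |: K)) = q |: (p |: (r |: K)) by rewrite setUCA.
    by apply: two => //; rewrite 1?eq_sym // pair_degC.
  exfalso; apply: (contra p q r) => //; rewrite 1?eq_sym //;
    rewrite ?(pair_degC K r) //; pos_lia.
- case: c3 => c3.
    have -> : p |: (q |: (r |: K)) = r |: (p |: (q |: K)).
      by rewrite (setUCA [set q]) (setUCA [set p]) (setUCA [set r]).
    by apply: two => //; rewrite 1?eq_sym // pair_degC.
  exfalso; apply: (contra p r q) => //; rewrite 1?eq_sym // ?(pair_degC K q p) //.
    by rewrite noncol_swapr; pos_lia.
- case: c3 => c3; last by exfalso; move: hm; move: (nat_of_bool _); pos_lia.
  exfalso; apply: (contra q r p) => //; rewrite 1?eq_sym //.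
  by rewrite -noncol_rot; pos_lia.
Qed.

End Three.

(* The codes of the pairs (x, y), (y, z), (x, z) for a point [p] and x, y, z in
   this order: 0, 1, 2 if [p] is before, inside, after the pair, 3 if the three
   points form a triangle. *)
Definition allowed (a b c : nat) := (a, b, c) \in
  [:: (0,0,0); (2,2,2); (1,0,1); (2,1,1); (0,2,1); (0,2,3); (2,0,3); (3,0,3);
      (3,3,1); (3,3,3); (3,2,1); (3,2,3); (0,3,1); (0,3,3); (2,3,3)].

(* [aij] is the code of the pair (xi, xj) of an ordered set x0, ..., x4.  The
   conditionals are lazy under [vm_compute], unlike [==>]. *)
Definition base_check :=
  let R := iota 0 4 in
  all (fun a01 => all (fun a12 => all (fun a02 => if ~~ allowed a01 a12 a02 then true else
  all (fun a23 => all (fun a13 => if ~~ allowed a12 a23 a13 then true else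
  all (fun a03 => if ~~ (allowed a01 a13 a03 && allowed a02 a23 a03) then true else
  all (fun a34 => all (fun a24 => if ~~ allowed a23 a34 a24 then true else
  all (fun a14 => if ~~ (allowed a12 a24 a14 && allowed a13 a34 a14) then true else
  all (fun a04 => if ~~ ((allowed a01 a14 a04 && allowed a02 a24 a04) && allowed a03 a34
    a04) then true else
    (count_mem 3 [:: a01; a02; a03; a04; a12; a13; a14; a23; a24; a34] <= 2) ==>
    [|| 3 \notin [:: a12; a13; a14; a23; a24; a34],
        3 \notin [:: a02; a03; a04; a23; a24; a34],
        3 \notin [:: a01; a03; a04; a13; a14; a34],
        3 \notin [:: a01; a02; a04; a12; a14; a24]
      | 3 \notin [:: a01; a02; a03; a12; a13; a23]])
  R) R) R) R) R) R) R) R) R) R.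

(** At most two pairs without a common point must be two disjoint pairs. So the computation excludes
    that the triangles of [p] with a five-point line sit on exactly two disjoint pairs. *)
Lemma base_checkT : base_check. Proof. by vm_compute. Qed.

(** * Order six: a point added to a five-point line *)

Section BaseCase.

Variable B : betweenness.
Local Notation X := (point B).
Implicit Types (x y z w k p q r a b c : X) (S K : {set X}).

Definition code p x y :=
  if between p x y then 0 else if between x p y then 1 else if between x y p then 2 else
  3.

Lemma code_allowed p x y z : uniq [:: x; y; z] -> p \notin [:: x; y; z] ->
  between x y z ->
  allowed (code p x y) (code p y z) (code p x z).
Proof.
rewrite /= !inE !negb_or !andbT => /andP[/andP[n1 n2] n3] /and3P[n4 n5 n6] o.
rewrite /code; case: ifP => a1; [|case: ifP => a2; [|case: ifP => a3]];
 (case: ifP => b1; [|case: ifP => b2; [|case: ifP => b3]]);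
 (case: ifP => c1; [|case: ifP => c2; [|case: ifP => c3]]); rewrite ?/allowed //;
 exfalso; between_auto;
 match goal with N : between ?a ?b ?c = false, H : is_true (between ?a ?b ?c) |- _ =>
   by rewrite H in N end.
Qed.

Lemma codeT p x y : (code p x y == 3) = noncol p x y.
Proof.
rewrite /code /noncol (between_symE y p x); case: (between p x y) => //=.
by case: (between x p y); case: (between x y p).
Qed.

Lemma code_lt4 p x y : code p x y \in iota 0 4.
Proof. by rewrite /code; case: ifP => // _; case: ifP => // _; case: ifP. Qed.

Lemma link_deg_apex S p : p \in S -> triangle_free (S :\ p) ->
  2 * tri_num S = link_deg (S :\ p) p.
Proof.
move=> pS fL; have := triple_sumE S; rewrite -{1}(setD1K pS) triple_sumU1 ?setD11 //.
have -> : triple_sum (S :\ p) = 0 by apply/eqP/triple_sum_eq0.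
by pos_lia.
Qed.

Lemma ordered_enum K (pos : X -> nat) : ordered K pos ->
  exists s, [/\ uniq s, s =i K & forall i j x, i < j -> j < size s ->
    pos (nth x s i) < pos (nth x s j)].
Proof.
move=> [inj _]; exists (sort (relpre pos leq) (enum K)).
have us : uniq (sort (relpre pos leq) (enum K)) by rewrite sort_uniq enum_uniq.
have sE : sort (relpre pos leq) (enum K) =i K by move=> x; rewrite mem_sort mem_enum.
split=> // i j x ij js.
have so : sorted (relpre pos leq) (sort (relpre pos leq) (enum K)).
  by apply: sort_sorted => a b; apply: leq_total.
have tr : transitive (relpre pos leq) by move=> a b c; apply: leq_trans.
have is' := ltn_trans ij js.
have := sorted_ltn_nth tr x so i j is' js ij; rewrite /= leq_eqVlt => /orP[/eqP e|//].
have := inj _ _ _ _ e; rewrite -!sE !mem_nth // => /(_ isT isT) /eqP.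
by rewrite nth_uniq // => /eqP e'; move: ij; rewrite e' ltnn.
Qed.

(** All triangles contain [p], so they are the codes 3 of pairs of the line. A point of the line
    that lies in all these pairs forms the shared pair with [p]. Removing three of six points would
    leave too few for a gap, hence the table. *)
Lemma shared_line6 S p : #|S| = 6 -> p \in S -> triangle_free (S :\ p) ->
  tri_num S <= 2 -> shared S.
Proof.
move=> cS pS fL hm; set L := S :\ p in fL.
have cL : #|L| = 5 by move: cS; rewrite (cardsD1 p) pS add1n => -[].
have [|pos o] := triangle_free_ordered fL; first by rewrite cL.
have [s [us sL so]] := ordered_enum o.
have ss : size s = 5 by rewrite -(card_uniqP us) -cL; apply: eq_card.
have h := link_deg_apex pS fL; rewrite -/L in h.
have dE : link_deg L p = \sum_(y <- s) \sum_(z <- s) noncol p y z.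
  rewrite /link_deg big_uniq //; apply: eq_big => [y|y _]; first by rewrite sL.
  by rewrite /pair_deg [RHS]big_uniq //; apply: eq_bigl => z; rewrite sL.
have pL : p \notin s by rewrite sL setD11.
case: s us sL so ss dE pL => [|x0 [|x1 [|x2 [|x3 [|x4 [|]]]]]] // us sL so _ dE pL.
have so' i j : i < j -> j < 5 -> pos (nth p [:: x0; x1; x2; x3;
  x4] i) < pos (nth p [:: x0; x1; x2; x3; x4] j).
  exact: so.
have bts i j (k : nat) : i < j -> j < k -> k < 5 -> between (nth p [:: x0; x1; x2; x3;
  x4] i)
  (nth p [:: x0; x1; x2; x3; x4] j) (nth p [:: x0; x1; x2; x3; x4] k).
  move=> ij jk k5; have j5 := ltn_trans jk k5; have i5 := ltn_trans ij j5.
  apply: o.2; rewrite -?sL ?mem_nth //; exact: so'.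
have al i j (k : nat) : i < j -> j < k -> k < 5 -> allowed
  (code p (nth p [:: x0; x1; x2; x3; x4] i) (nth p [:: x0; x1; x2; x3; x4] j))
  (code p (nth p [:: x0; x1; x2; x3; x4] j) (nth p [:: x0; x1; x2; x3; x4] k))
  (code p (nth p [:: x0; x1; x2; x3; x4] i) (nth p [:: x0; x1; x2; x3; x4] k)).
  move=> ij jk k5; have j5 := ltn_trans jk k5; have i5 := ltn_trans ij j5.
  apply: code_allowed; last exact: bts.
    by rewrite /= !inE !nth_uniq // !negb_or ?andbT; clear -ij jk; lia.
  by apply/negP; rewrite !inE => /or3P[]/eqP e; move: pL; rewrite {1}e mem_nth.
have := base_checkT.
move=> /allP/(_ _ (code_lt4 p x0 x1))/allP/(_ _ (code_lt4 p x1 x2))/allP/(_ _ (code_lt4 p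
  x0 x2)).
rewrite (al 0 1 2) // => /allP/(_ _ (code_lt4 p x2 x3))/allP/(_ _ (code_lt4 p x1 x3)).
rewrite (al 1 2 3) // => /allP/(_ _ (code_lt4 p x0 x3)).
rewrite (al 0 1 3) // (al 0 2 3) // =>
  /allP/(_ _ (code_lt4 p x3 x4))/allP/(_ _ (code_lt4 p x2 x4)).
rewrite (al 2 3 4) // => /allP/(_ _ (code_lt4 p x1 x4)).
rewrite (al 1 2 4) // (al 1 3 4) // => /allP/(_ _ (code_lt4 p x0 x4)).
rewrite (al 0 1 4) // (al 0 2 4) // (al 0 3 4) //=.
rewrite !inE !negb_or !(eq_sym 3) !codeT.
move: dE; rewrite !big_cons !big_nil !noncol_xyy.
rewrite (noncol_swapr p x1 x0) (noncol_swapr p x2 x0) (noncol_swapr p x3 x0)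
  (noncol_swapr p x4 x0).
rewrite (noncol_swapr p x2 x1) (noncol_swapr p x3 x1) (noncol_swapr p x4 x1).
rewrite (noncol_swapr p x3 x2) (noncol_swapr p x4 x2) (noncol_swapr p x4 x3).
move=> dE; case: leqP => [_ /=|]; last by move: dE h hm; clear; pos_lia.
have fin x : x \in S -> x != p -> (forall y z, y \in L -> z \in L -> y != x ->
  z != x -> ~~ noncol p y z) ->
    shared S.
  move=> xS xp hx; exists x, p; split=> //.
  have hx' y z : y \in S :\ x -> z \in S :\ x -> ~~ noncol p y z.
    have [->|yp] := eqVneq y p; first by rewrite noncol_xx.
    have [->|zp] := eqVneq z p; first by rewrite noncol_xyx.
    by rewrite !inE => /andP[? ?] /andP[? ?]; apply: hx; rewrite // !inE ?yp ?zp.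
  move=> a b c aS bS cS'.
  have [e|ap] := eqVneq a p; first by rewrite e; apply: hx'.
  have [e|bp] := eqVneq b p; first by rewrite e noncol_swap; apply: hx'.
  have [e|cp] := eqVneq c p; first by rewrite e -noncol_rot; apply: hx'.
  have sub y : y \in S :\ x -> y != p -> y \in L.
    by rewrite !inE => /andP[_ ->] ->.
  by apply: fL; apply: sub.
have LS y : y \in [:: x0; x1; x2; x3; x4] -> y \in S /\ y != p.
  by rewrite sL !inE => /andP[].
have [x0S n0] := LS x0 ltac:(by rewrite !inE eqxx ?orbT).
have [x1S n1] := LS x1 ltac:(by rewrite !inE eqxx ?orbT).
have [x2S n2] := LS x2 ltac:(by rewrite !inE eqxx ?orbT).
have [x3S n3] := LS x3 ltac:(by rewrite !inE eqxx ?orbT).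
have [x4S n4] := LS x4 ltac:(by rewrite !inE eqxx ?orbT).
case/or4P => [|||/orP[]]; (do 5!case/andP=> ?) => ?;
 [apply: (fin x0)|apply: (fin x1)|apply: (fin x2)|apply: (fin x3)|apply: (fin x4)] => //;
 move=> y z; rewrite -!sL !inE; case/or4P => [|||/orP[]] /eqP ->; case/or4P =>
   [|||/orP[]] /eqP ->;
 rewrite ?eqxx ?noncol_xyy //; by rewrite noncol_swapr.
Qed.

End BaseCase.

(** * Few triangles *)

Section Induction.

Variable B : betweenness.
Local Notation X := (point B).
Implicit Types (x y z w k p q r a b c : X) (S K : {set X}).

Lemma setD3K S p q r : p \in S -> q \in S -> r \in S -> p != q -> p != r -> q != r ->
  S = p |: (q |: (r |: (S :\ p :\ q :\ r))).
Proof.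
move=> pS qS rS npq npr nqr.
have r' : r \in S :\ p :\ q by rewrite !inE rS !(eq_sym r) npr nqr.
have q' : q \in S :\ p by rewrite !inE qS eq_sym npq.
by rewrite (setD1K r') (setD1K q') (setD1K pS).
Qed.

(** For [K] of order [#|S| - 3] the bound [2 * #|K| - 4] is [2 * #|S| - 10], and order at least
    seven leaves four points in [K]. *)
Lemma shared_of_three_insertions S p q r : 6 < #|S| -> p \in S -> q \in S -> r \in S ->
  p != q -> p != r -> q != r ->
  triangle_free (S :\ q :\ r) -> triangle_free (S :\ p :\ r) ->
    triangle_free (S :\ p :\ q) ->
  tri_num S <= 2 * #|S| - 10 -> shared S.
Proof.
move=> cS pS qS rS npq npr nqr fp fq fr.
have e := setD3K pS qS rS npq npr nqr.
have cK : #|S| = #|S :\ p :\ q :\ r| + 3.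
  rewrite (cardsD1 p S) pS (cardsD1 q (S :\ p)) (cardsD1 r (S :\ p :\ q)) !inE qS rS.
  by rewrite (eq_sym q) npq (eq_sym r) nqr (eq_sym r) npr; pos_lia.
rewrite cK {1 3}e => hm; apply: three_insertions_setU => //; rewrite ?inE ?eqxx ?andbF //.
- by pos_lia.
- apply: triangle_freeS fp; apply/subsetP => x; rewrite !inE => /orP[/eqP->|/and4P[->
  -> _ ->]] //.
  by rewrite npq npr.
- apply: triangle_freeS fq; apply/subsetP => x; rewrite !inE => /orP[/eqP->|/and4P[->
  _ -> ->]] //.
  by rewrite nqr eq_sym npq.
- apply: triangle_freeS fr; apply/subsetP => x; rewrite !inE => /orP[/eqP->|/and4P[_ ->
  -> ->]] //.
  by rewrite eq_sym nqr eq_sym npr.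
- by pos_lia.
Qed.

Lemma pair_degS K S a b : K \subset S -> pair_deg K a b <= pair_deg S a b.
Proof.
move=> /setIidPr e; rewrite /pair_deg [leqRHS](big_setID K) /= e; exact: leq_addr.
Qed.

Lemma tri_numD1 S x : x \in S ->
  2 * tri_num S = 2 * tri_num (S :\ x) + link_deg (S :\ x) x.
Proof.
move=> xS; have := triple_sumE S; have := triple_sumE (S :\ x).
have : triple_sum S = triple_sum (S :\ x) + 3 * link_deg (S :\ x) x by rewrite
  -triple_sumU1 ?setD11 // setD1K.
by pos_lia.
Qed.

(** The triangles that avoid [x] and those on the pair [{x, y}] are disjoint families. *)
Lemma tri_numD1_ge S x y : x \in S -> y \in S -> x != y ->
  tri_num (S :\ x) + pair_deg (S :\ x :\ y) x y <= tri_num S.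
Proof.
move=> xS yS nxy; have h := tri_numD1 xS.
have yS' : y \in S :\ x by rewrite !inE eq_sym nxy.
have h2 : link_deg (S :\ x) x = link_deg (S :\ x :\ y) x + 2 * pair_deg (S :\ x :\ y) x y.
  by rewrite -{1}(setD1K yS') link_degU1 ?setD11.
by move: h; rewrite h2; pos_lia.
Qed.

Lemma tri_numS S K : K \subset S -> tri_num K <= tri_num S.
Proof.
move=> KS; apply/subset_leq_card/subsetP => A; rewrite !inE => /andP[-> AK].
exact: subset_trans AK KS.
Qed.

Lemma triangle_free_dec S : decidable (triangle_free S).
Proof.
by case E: (tri_num S == 0); [left; apply/tri_num_eq0/eqP|right => /tri_num_eq0 e;
  rewrite e in E].
Qed.

Lemma shared_tri_num S c p : c \in S -> p \in S -> c != p -> triangle_free (S :\ c) ->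
  triangle_free (S :\ p) ->
  tri_num S = pair_deg (S :\ c :\ p) c p.
Proof.
move=> cS pS ncp fc fp; have h := tri_numD1 cS.
have pS' : p \in S :\ c by rewrite !inE eq_sym ncp.
have h2 : link_deg (S :\ c) c = link_deg (S :\ c :\ p) c + 2 * pair_deg (S :\ c :\ p) c p.
  by rewrite -{1}(setD1K pS') link_degU1 ?setD11.
have h3 : link_deg (S :\ c :\ p) c = 0.
  apply: (triangle_free_link_deg fp); last by rewrite !inE ncp.
  by apply/subsetP => x; rewrite !inE => /and3P[-> _].
by move: h; rewrite h2 h3 (_ : tri_num (S :\ c) = 0); [pos_lia|apply/tri_num_eq0].
Qed.

Lemma shared_count S : 5 < #|S| -> shared S -> tri_num S = 0 \/ #|S| <= tri_num S + 4.
Proof.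
move=> cS [c [p [cS' pS ncp fc fp]]]; rewrite (shared_tri_num cS' pS ncp fc fp).
have pS' : p \in S :\ c by rewrite !inE eq_sym ncp.
have c2 : #|S| = #|S :\ c :\ p| + 2.
  by rewrite (cardsD1 c S) cS' (cardsD1 p (S :\ c)) pS'; pos_lia.
have f1 : triangle_free (c |: (S :\ c :\ p)).
  apply: triangle_freeS fp; apply/subsetP => x; rewrite !inE => /orP[/eqP->|/and3P[->
    _ ->]] //.
  by rewrite ncp.
have f2 : triangle_free (p |: (S :\ c :\ p)).
  apply: triangle_freeS fc; apply/subsetP => x; rewrite !inE => /orP[/eqP->|/and3P[_ ->
    ->]] //.
  by rewrite eq_sym ncp.
have hK : 3 < #|S :\ c :\ p| by pos_lia.
have cK : c \notin S :\ c :\ p by rewrite !inE eqxx andbF.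
have [h|h] := insert_pair_count hK f1 f2 cK (negbT (setD11 _ _)) ncp; first by left.
by right; pos_lia.
Qed.

Lemma shared_upper S : shared S -> tri_num S + 2 <= #|S|.
Proof.
case=> [c [p [cS' pS ncp fc fp]]]; rewrite (shared_tri_num cS' pS ncp fc fp).
have pS' : p \in S :\ c by rewrite !inE eq_sym ncp.
have c2 : #|S| = #|S :\ c :\ p| + 2.
  by rewrite (cardsD1 c S) cS' (cardsD1 p (S :\ c)) pS'; pos_lia.
by have := pair_deg_le (S :\ c :\ p) c p; pos_lia.
Qed.

Lemma shared_line n S p : #|S| = n + 6 -> p \in S -> triangle_free (S :\ p) ->
  tri_num S <= 2 * #|S| - 10 -> shared S.
Proof.
elim: n S => [|n IH] S cS pS fL hm.
  by apply: (shared_line6 _ pS fL) => //; rewrite cS in hm.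
have cL : #|S :\ p| = n + 6 by move: cS; rewrite (cardsD1 p) pS; pos_lia.
(* [2 * #|S| - 12] is the bound for order [#|S| - 1]. If every deletion left more, each [c] would be
   in at most one triangle, since all triangles contain [p]. Then twice their number is at most
   [#|S| - 1], although there are at least [2 * #|S| - 11] of them. *)
have [c cL' hc] : exists2 c, c \in S :\ p & tri_num (S :\ c) <= 2 * #|S| - 12.
  apply/exists_inP; apply: contraT; rewrite negb_exists_in => /forall_inP h.
  have key c : c \in S :\ p ->
    pair_deg (S :\ p) p c <= 1 /\ (tri_num S = 2 * #|S| - 11 ->
    pair_deg (S :\ p) p c = 0).
    move=> cL'; have := h c cL'; rewrite -ltnNge => h'.
    have := cL'; rewrite !inE => /andP[ncp cS'].
    have := tri_numD1_ge cS' pS ncp.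
    have -> : pair_deg (S :\ c :\ p) c p = pair_deg (S :\ p) p c.
      rewrite /pair_deg (bigD1 (P := fun k => k \in S :\ p) c) //= noncol_xyy add0n.
      apply: eq_big => k; last by rewrite noncol_swap.
      by rewrite !inE; case: (k == p); case: (k == c); rewrite /= ?andbF ?andbT.
    by move: h' hm; clear; lia.
  have hd := link_deg_apex pS fL.
  have le1 : link_deg (S :\ p) p <= #|S :\ p|.
    by rewrite /link_deg -sum1_card; apply: leq_sum => c /key[].
  (* The count alone leaves order 7 with three triangles; there the number is [2 * #|S| - 11], and
     no deletion of a [c] may destroy any triangle. *)
  have eq0 : tri_num S = 2 * #|S| - 11 -> link_deg (S :\ p) p = 0.
    by move=> e; apply: big1 => c /key[_]; apply.
  have [c0 c0L] : exists c, c \in S :\ p by apply/card_gt0P; rewrite cL; clear; lia.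
  have m1 : 2 * #|S| - 12 < tri_num S.
    have := h _ c0L; rewrite -ltnNge => h'; apply: leq_trans h' _; apply: tri_numS.
    by apply: subD1set.
  by move: hd le1 eq0 cL cS hm m1; clear; move: (tri_num S) (link_deg _ _) #|S| => *; lia.
move: cL'; rewrite !inE => /andP[ncp cS'].
have cSc : #|S :\ c| = n + 6 by move: cS; rewrite (cardsD1 c) cS'; pos_lia.
have [||||a [b [aS bS nab fa fb]]] := IH (S :\ c).
- by [].
- by rewrite !inE eq_sym ncp.
- by apply: triangle_freeS fL; rewrite setDDl setUC -setDDl subD1set.
- by move: hc cSc cS; clear; lia.
(* One point of the pair shared by [S :\ c] differs from [p]. Among [p], [c], [q], the two deletions
   that include [p] leave no triangle because [S :\ p] has none. *)
have [q [qS nqp fq]] : exists q, [/\ q \in S :\ c, q != p & triangle_free (S :\ c :\ q)].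
  have [e|n1] := eqVneq a p; last by exists a.
  by exists b; split=> //; rewrite -e eq_sym.
move: qS; rewrite !inE => /andP[nqc qS].
apply: (@shared_of_three_insertions S p c q) => //; rewrite 1?eq_sym //.
- by rewrite cS; clear; lia.
- by apply: triangle_freeS fL; apply: subD1set.
- by apply: triangle_freeS fL; apply: subD1set.
Qed.

(** Each triangle survives the deletion of the [#|S| - 3] points outside it, so the numbers after
    one deletion add up to [(#|S| - 3) * tri_num S]. *)
Lemma averaging S (k : nat) : (#|S| - 3) * tri_num S < #|S| * k -> exists2 p,
  p \in S & tri_num (S :\ p) < k.
Proof.
move=> h; apply/exists_inP; apply: contraLR h; rewrite negb_exists_in => /forall_inP h.
rewrite -leqNgt; have [lt3|ge3] := ltnP #|S| 3.
  have : tri_num S = 0.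
    apply: eq_card0 => A; rewrite !inE; apply/negbTE; apply/negP =>
      /andP[/andP[/eqP cA _]].
    by move=> /subset_leq_card; rewrite cA leqNgt lt3.
  move=> m0; suff -> : #|S| * k = 0 by [].
  have [->//|k0] := posnP k; first by rewrite muln0.
  apply/eqP; rewrite muln_eq0 cards_eq0; apply/orP; left; apply/set0Pn => -[p pS].
  have := h p pS; rewrite -leqNgt => /leq_trans /(_ (tri_numS (subD1set S p))).
  by rewrite m0; pos_lia.
have dE p : p \in S -> link_deg S p = link_deg (S :\ p) p.
  by move=> pS; rewrite -{1}(setD1K pS) link_degU1 ?setD11 // /pair_deg big1 => [|i _];
    rewrite ?muln0 ?addn0 ?noncol_xx.
have : \sum_(p in S) (2 * k) <= \sum_(p in S) 2 * tri_num (S :\ p).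
  by apply: leq_sum => p /h; rewrite -leqNgt leq_pmul2l.
rewrite sum_nat_const.
have : \sum_(p in S) 2 * tri_num (S :\ p) + \sum_(p in S) link_deg S p = \sum_(p in S) 2
  * tri_num S.
  by rewrite -big_split; apply: eq_bigr => p pS /=; rewrite dE // -tri_numD1.
rewrite sum_nat_const -/(triple_sum S) triple_sumE; move: (\sum_(p in S) _) => s.
move: ge3; move: #|S| (tri_num S) => n mm h3 e1 e2.
have : n = (n - 3) + 3 by lia.
by move: (n - 3) e1 e2 => n' e1 e2 en; subst n; nia.
Qed.

Lemma tri_numD1_lt S a b c : a \in S -> b \in S -> c \in S -> noncol a b c ->
  tri_num (S :\ a) < tri_num S.
Proof.
move=> aS bS cS n; have := tri_numD1 aS.
have := noncol_uniq n; rewrite /= !inE !negb_or !andbT => /andP[/andP[nab nac] nbc].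
have : 0 < link_deg (S :\ a) a.
  rewrite /link_deg (bigD1 b) ?inE 1?eq_sym ?nab //=.
  by rewrite /pair_deg (bigD1 c) ?inE 1?eq_sym ?nac //= n.
by pos_lia.
Qed.

Lemma not_triangle_free S : ~ triangle_free S -> exists a b c, [/\ a \in S, b \in S,
  c \in S & noncol a b c].
Proof.
move=> h; have [/existsP[a /existsP[b /existsP[c /and4P[? ? ? ?]]]]|no] :=
  boolP [exists a, exists b, exists c, [&& a \in S, b \in S, c \in S & noncol a b c]].
  by exists a, b, c.
case: h => a b c aS bS cS; apply: contraNN no => n.
apply/existsP; exists a; apply/existsP; exists b; apply/existsP; exists c.
by rewrite aS bS cS.
Qed.

Lemma shared_le1 S : 1 < #|S| -> tri_num S <= 1 -> shared S.
Proof.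
move=> cS hm; have [f|nf] := triangle_free_dec S.
  case/card_gt1P: cS => a [b [aS bS nab]]; exists a, b.
  by split=> //; apply: triangle_freeS f; apply: subD1set.
have [a [b [c [aS bS cS' n]]]] := not_triangle_free nf.
have := noncol_uniq n; rewrite /= !inE !negb_or => /andP[/andP[nab _] _].
have n' : noncol b a c by rewrite noncol_swap.
have h1 := tri_numD1_lt aS bS cS' n; have h2 := tri_numD1_lt bS aS cS' n'.
by exists a, b; split=> //; apply/tri_num_eq0; pos_lia.
Qed.

Lemma shared_lt n S : #|S| = n + 6 -> tri_num S + 10 < 2 * #|S| -> shared S.
Proof.
elim: n S => [|n IH] S cS hm.
  (* At order six the bound leaves at most one triangle. *)
  by apply: shared_le1; rewrite cS in hm *; pos_lia.
(* The least nonzero number of triangles in the previous order, which follows from the induction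
   hypothesis. *)
have min S' : #|S'| = n + 6 -> ~ triangle_free S' -> #|S'| <= tri_num S' + 4.
  move=> cS' nf; have [h|h] := ltnP (tri_num S' + 10) (2 * #|S'|); last by pos_lia.
  have [|e|//] := shared_count _ (IH S' cS' h); first by pos_lia.
  by case: nf; apply/tri_num_eq0.
(* Fewer than [2 * #|S| - 12] triangles is the induction bound for the order of [S :\ p]. *)
have [|p pS hp] := @averaging S (2 * #|S| - 12).
  have : tri_num S <= 2 * n + 3 by pos_lia.
  by rewrite cS; move: (tri_num S) => mm; clear; nia.
have cSp : #|S :\ p| = n + 6 by move: cS; rewrite (cardsD1 p) pS; pos_lia.
have [f|nf] := triangle_free_dec (S :\ p).
  by apply: (shared_line cS pS f); pos_lia.
have [|q [r [qS' rS' nqr fq fr]]] := IH _ cSp; first by pos_lia.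
move: (qS') (rS'); rewrite !inE => /andP[nqp qS] /andP[nrp rS].
have [f|nf2] := triangle_free_dec (S :\ q :\ r).
  by apply: (@shared_of_three_insertions S p q r) => //; rewrite 1?eq_sym //; pos_lia.
(* The triangles on [{q, r}] include all those of [S :\ p], and those of [S :\ q] are disjoint from
   them; both families have at least [#|S| - 5] members. *)
have h1 : tri_num (S :\ p) <= pair_deg (S :\ q :\ r) q r.
  rewrite (shared_tri_num qS' rS' nqr fq fr); apply: pair_degS; apply/subsetP => x.
  by rewrite !inE => /and4P[-> -> _ ->].
have h2 := tri_numD1_ge qS rS nqr.
have cSq : #|S :\ q| = n + 6 by move: cS; rewrite (cardsD1 q) qS; pos_lia.
have nf3 : ~ triangle_free (S :\ q) by move=> f; apply: nf2; apply: triangle_freeS f;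
  apply: subD1set.
have h3 := min _ cSp nf; have h4 := min _ cSq nf3.
by exfalso; pos_lia.
Qed.

Lemma tri_num_min S : 5 < #|S| -> ~ triangle_free S -> #|S| <= tri_num S + 4.
Proof.
move=> cS nf; have [h|h] := ltnP (tri_num S + 10) (2 * #|S|); last by pos_lia.
have e : #|S| = (#|S| - 6) + 6 by pos_lia.
have [|e'|//] := shared_count _ (shared_lt e h); first by pos_lia.
by case: nf; apply/tri_num_eq0.
Qed.

End Induction.

(** * Exactly 2n - 10 triangles *)

Section Extremal.

Variable B : betweenness.
Local Notation X := (point B).
Implicit Types (x y z w k p q r a b c : X) (S K : {set X}).

Lemma link_deg_eq0 S x : link_deg S x = 0 -> forall y z, y \in S -> z \in S ->
  ~~ noncol x y z.
Proof.
move=> /eqP; rewrite sum_nat_eq0 => /forall_inP h y z yS zS.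
by have := h y yS; rewrite sum_nat_eq0 => /forall_inP/(_ z zS); case: noncol.
Qed.

Lemma triangle_freeD1 S x : (forall y z, y \in S -> z \in S -> ~~ noncol x y z) ->
  triangle_free (S :\ x) -> triangle_free S.
Proof.
move=> hx f a b c aS bS cS.
have [e|ax] := eqVneq a x; first by rewrite e hx.
have [e|bx] := eqVneq b x; first by rewrite e noncol_swap hx.
have [e|cx] := eqVneq c x; first by rewrite e -noncol_rot hx.
by apply: f; rewrite !inE ?ax ?bx ?cx.
Qed.

Lemma setD1C S x y : S :\ x :\ y = S :\ y :\ x.
Proof. by rewrite !setDDl setUC. Qed.

Lemma pair_degD1 S x a b : x \in S ->
  pair_deg S a b = noncol a b x + pair_deg (S :\ x) a b.
Proof. by move=> xS; rewrite -{1}(setD1K xS) pair_degU1 ?setD11. Qed.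

Lemma link_degD1 S x y : y \in S ->
  link_deg S x = link_deg (S :\ y) x + 2 * pair_deg (S :\ y) x y.
Proof. by move=> yS; rewrite -{1}(setD1K yS) link_degU1 ?setD11. Qed.

(* The triangles of [S] are those on the pairs [{p, z}] and [{q, r}], and there
   are [#|S| - 5] on each. *)
Definition config S p z q r :=
  [/\ uniq [:: p; z; q; r], {subset [:: p; z; q; r] <= S},
     [/\ triangle_free (S :\ p :\ q), triangle_free (S :\ p :\ r),
       triangle_free (S :\ z :\ q) & triangle_free (S :\ z :\ r)],
     [/\ ~~ noncol q r p, ~~ noncol q r z, ~~ noncol p z q & ~~ noncol p z r] &
     [/\ pair_deg (S :\ p :\ q :\ r) q r + 5 = #|S|,
       pair_deg (S :\ z :\ q :\ r) q r + 5 = #|S|,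
         pair_deg (S :\ q :\ p :\ z) p z + 5 = #|S| & pair_deg (S :\ r :\ p :\ z) p z + 5
           = #|S|]].

Lemma extremal_config S : 8 < #|S| -> tri_num S + 10 = 2 * #|S| -> exists p z q r,
  config S p z q r.
Proof.
move=> cS hm.
(* A shared set has at most [#|S| - 2] triangles, and [2 * #|S| - 10] is larger exactly when
   [#|S| > 8]. *)
have ns : ~ shared S by move=> /shared_upper; clear -cS hm; lia.
have [|p pS hp] := @averaging _ S (2 * #|S| - 12).
  have [n hn] : exists n, #|S| = n + 9 by exists (#|S| - 9); clear -cS; lia.
  by rewrite hn in hm *; rewrite (_ : tri_num S = 2 * n + 8); [clear; nia | clear -hm;
    lia].
have c1 x : x \in S -> #|S| = #|S :\ x| + 1 by move=> xS; rewrite (cardsD1 x S) xS addnC.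
have cp := c1 _ pS.
have [f|nf] := triangle_free_dec (S :\ p).
  case: ns; apply: (@shared_line _ (#|S| - 6) S p) => //; clear -cS hm; lia.
have [||q [r [qS' rS' nqr fq fr]]] := @shared_lt _ (#|S :\ p| - 6) (S :\ p).
- by clear -cS cp; lia.
- by clear -cS cp hp hm; lia.
move: (qS') (rS'); rewrite !inE => /andP[nqp qS] /andP[nrp rS].
have [f|nf2] := triangle_free_dec (S :\ q :\ r).
  case: ns; apply: (@shared_of_three_insertions _ S p q r) => //; rewrite 1?eq_sym //;
    clear -cS hm; lia.
have cq := c1 _ qS; have cr := c1 _ rS.
have pU : p \in S :\ q :\ r by rewrite !inE eq_sym nrp eq_sym nqp.
have e0 : S :\ q :\ r :\ p = S :\ p :\ q :\ r.
  by apply/setP => x; rewrite !inE; do 3!case: (x == _); rewrite ?andbF.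
have mp : tri_num (S :\ p) = pair_deg (S :\ p :\ q :\ r) q r :=
  shared_tri_num qS' rS' nqr fq fr.
have tU := pair_degD1 q r pU; rewrite e0 in tU.
have h2 := tri_numD1_ge qS rS nqr.
have nrq : r != q by rewrite eq_sym.
have h2' := tri_numD1_ge rS qS nrq.
rewrite (setD1C S r q) pair_degC in h2'.
have nfq : ~ triangle_free (S :\ q) by move=> f; apply: nf2; apply: triangle_freeS f;
  apply: subD1set.
have nfr : ~ triangle_free (S :\ r).
  by move=> f; apply: nf2; rewrite setD1C; apply: triangle_freeS f; apply: subD1set.
have h3 : #|S :\ p| <= tri_num (S :\ p) + 4 by apply: tri_num_min nf; clear -cS cp; lia.
have h4 : #|S :\ q| <= tri_num (S :\ q) + 4 by apply: tri_num_min nfq; clear -cS cq; lia.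
have h5 : #|S :\ r| <= tri_num (S :\ r) + 4 by apply: tri_num_min nfr; clear -cS cr; lia.
(* Two families of at least [#|S| - 5] triangles share a total of [2 * #|S| - 10], so every
   inequality so far is an equality. *)
have [tUv mpv mqv mrv] : [/\ pair_deg (S :\ q :\ r) q r + 5 = #|S|,
  pair_deg (S :\ p :\ q :\ r) q r + 5 = #|S|,
   tri_num (S :\ q) + 5 = #|S| & tri_num (S :\ r) + 5 = #|S|].
  by move: mp tU; clear -h2 h2' h3 h4 h5 hm cp cq cr; case: noncol => /= mp tU; split;
    lia.
have nqrp : ~~ noncol q r p by move: tU tUv mpv; clear; case: noncol => //=; lia.
have rSq : r \in S :\ q by rewrite !inE eq_sym nqr.
have qSr : q \in S :\ r by rewrite !inE nqr.
(* Equality in [tri_numD1_ge]: every triangle through [q] contains [r], and likewise with [q] and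
   [r] exchanged. *)
have dq : link_deg (S :\ q :\ r) q = 0.
  have := tri_numD1 qS; rewrite (link_degD1 q rSq); clear -tUv mqv hm; lia.
have dr : link_deg (S :\ q :\ r) r = 0.
  have := tri_numD1 rS; rewrite (link_degD1 r qSr) (setD1C S r q) (pair_degC _ r q);
    clear -tUv mrv hm; lia.
have [||a [b [aS bS nab fa fb]]] := @shared_lt _ (#|S :\ q| - 6) (S :\ q).
- by clear -cS cq; lia.
- by clear -cS cq mqv hm; lia.
(* [S :\ q] is shared as well. Deleting [p] from it already leaves no triangle, so a point of its
   shared pair other than [p] serves as the partner of [p]. *)
have [z [zS nzp fz fzp]] : exists z, [/\ z \in S :\ q, z != p,
  triangle_free (S :\ q :\ z) & triangle_free (S :\ q :\ p)].
  have fp : triangle_free (S :\ q :\ p) by rewrite setD1C.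
  have [e|nap] := eqVneq a p; first by exists b; split=> //; rewrite -e eq_sym.
  by exists a.
have nzr : z != r by apply/eqP => e; apply: nf2; rewrite -e.
move: (zS); rewrite inE in_set1 => /andP[nzq zS'].
have cz := c1 _ zS'.
have q0 := link_deg_eq0 dq; have r0 := link_deg_eq0 dr.
have fzr : triangle_free (S :\ z :\ r).
  apply: (@triangle_freeD1 _ q).
    move=> x y; rewrite !inE => /and3P[xr _ xS] /and3P[yr _ yS].
    have [->|xq] := eqVneq x q; first by rewrite noncol_xx.
    have [->|yq] := eqVneq y q; first by rewrite noncol_xyx.
    by apply: q0; rewrite !inE ?xr ?xq ?yr ?yq.
  by apply: triangle_freeS fz; apply/subsetP => x; rewrite !inE => /and4P[-> _ -> ->].
have fzq : triangle_free (S :\ z :\ q) by rewrite setD1C.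
have pSq : p \in S :\ q by rewrite !inE eq_sym nqp.
have pSr : p \in S :\ r by rewrite !inE eq_sym nrp.
have zSr : z \in S :\ r by rewrite !inE nzr.
have npz : p != z by rewrite eq_sym.
have mq2 := shared_tri_num pSq zS npz fzp fz.
have mr2 : tri_num (S :\ r) = pair_deg (S :\ r :\ p :\ z) p z.
  by apply: shared_tri_num => //; rewrite setD1C.
have qSz : q \in S :\ z by rewrite !inE eq_sym nzq.
have rSz : r \in S :\ z by rewrite !inE eq_sym nzr.
have mz := shared_tri_num qSz rSz nqr fzq fzr.
have zU : z \in S :\ q :\ r by rewrite !inE nzr nzq.
have tU2 := pair_degD1 q r zU.
have e1 : S :\ q :\ r :\ z = S :\ z :\ q :\ r.
  by apply/setP => x; rewrite !inE; do 3!case: (x == _); rewrite ?andbF.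
rewrite e1 in tU2.
(* Otherwise [S :\ z] would have [#|S| - 6] triangles, one less than the minimum for its order. *)
have nqrz : ~~ noncol q r z.
  apply/negP => n; rewrite n in tU2.
  have : ~ triangle_free (S :\ z) by move=> /tri_num_eq0; clear -tU2 tUv mz cS; lia.
  move=> /tri_num_min h; have : 5 < #|S :\ z| by clear -cS cz; lia.
  by move=> /h; clear -tU2 tUv mz cz; lia.
rewrite (negPf nqrz) in tU2.
exists p, z, q, r; split=> //.
- by rewrite /= !inE !negb_or npz (eq_sym p) nqp (eq_sym p) nrp nzq nzr nqr.
- by move=> x; rewrite !inE => /or4P[]/eqP->.
- by split=> //; rewrite -noncol_rot; [apply: q0|apply: r0].
- by split=> //; [clear -tU2 tUv; lia|rewrite -mq2|rewrite -mr2].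
Qed.

End Extremal.

(** * Positions of the twins in the extremal configuration *)

Section Positions.

Variable B : betweenness.
Local Notation X := (point B).
Implicit Types (x y z w k p q r a b c : X) (S K : {set X}).

(** Once all values below [#|S|] are taken, neighbours in the order are points whose positions
    differ by 1. *)
Lemma ordered_rank S pos : ordered S pos -> exists pos', [/\ ordered S pos',
  forall x, x \in S -> pos' x < #|S| &
  forall v, v < #|S| -> exists2 x, x \in S & pos' x = v].
Proof.
move=> o; have [s [us sS so]] := ordered_enum o.
have ss : size s = #|S| by rewrite -(card_uniqP us); apply: eq_card.
have lt x y : y \in S -> index x s < index y s -> pos x < pos y.
  rewrite -sS => yS l; have ly : index y s < size s by rewrite index_mem.
  have := so _ _ x l ly; rewrite !nth_index // -index_mem; exact: ltn_trans l ly.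
exists (index^~ s); split.
- split=> [x y xS yS e|x y z xS yS zS l1 l2].
    by move: xS yS e; rewrite -!sS => xS yS; exact: index_inj.
  by apply: o.2 => //; apply: lt.
- by move=> x; rewrite -ss index_mem sS.
- move=> v lv; have [x0 _] : exists x, x \in S by apply/card_gt0P;
  apply: leq_ltn_trans lv.
  by exists (nth x0 s v); rewrite -?sS ?mem_nth ?index_uniq ?ss.
Qed.

(** With [config_swap] this generates the symmetries of the configuration, which carry facts about
    [r] and [q] to either pair in either order. *)
Lemma config_symr S p z q r : config S p z q r -> config S p z r q.
Proof.
case=> u sub [f1 f2 f3 f4] [n1 n2 n3 n4] [t1 t2 t3 t4]; split.
- by move: u; rewrite /= !inE !negb_or !andbT (eq_sym r q) => /and3P[/and3P[-> ->
  ->] /andP[-> ->] ->].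
- by move=> x; rewrite !inE => h; apply: sub; rewrite !inE; case/or4P: h => ->;
  rewrite ?orbT.
- by [].
- by split=> //; rewrite noncol_swap.
- by split=> //; rewrite setD1C pair_degC.
Qed.

Lemma config_swap S p z q r : config S p z q r -> config S q r p z.
Proof.
case=> u sub [f1 f2 f3 f4] [n1 n2 n3 n4] [t1 t2 t3 t4]; split.
- move: u; rewrite /= !inE !negb_or !andbT (eq_sym q p) (eq_sym q z) (eq_sym r p) (eq_sym
  r z).
  by case/and3P=> /and3P[-> -> ->] /andP[-> ->] ->.
- by move=> x; rewrite !inE => h; apply: sub; rewrite !inE; case/or4P: h => ->;
  rewrite ?orbT.
- by split; rewrite setD1C.
- by [].
- by [].
Qed.

Lemma config_syml S p z q r : config S p z q r -> config S z p q r.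
Proof. by move/config_swap/config_symr/config_swap. Qed.

Lemma config_mem S p z q r : config S p z q r ->
  [/\ [/\ p \in S, z \in S, q \in S & r \in S], p != z, p != q, p != r & [/\ z != q,
    z != r & q != r]].
Proof.
case=> u sub _ _ _.
have [pS zS qS rS] : [/\ p \in S, z \in S, q \in S & r \in S].
  by split; apply: sub; rewrite !inE eqxx ?orbT.
by move: u; rewrite /= !inE !negb_or !andbT =>
  /and3P[/and3P[npz npq npr] /andP[nzq nzr] nqr].
Qed.

Lemma config_facts S p z q r : config S p z q r -> 8 < #|S| ->
  let K := S :\ p :\ q :\ r in
  [/\ [/\ z \in K, #|K| + 3 = #|S|, p \notin K, q \notin K & r \notin K],
      triangle_free (q |: K), triangle_free (r |: K), q != r /\ pair_deg K r q + 2 = #|K|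
    & #|S| = #|K :\ z| + 4].
Proof.
move=> cf cS K; have [[pS zS qS rS] npz npq npr [nzq nzr nqr]] := config_mem cf.
case: cf => _ _ [f1 f2 f3 f4] [n1 n2 n3 n4] [t1 t2 t3 t4].
have r' : r \in S :\ p :\ q by rewrite !inE rS !(eq_sym r) npr nqr.
have q' : q \in S :\ p by rewrite !inE qS eq_sym npq.
have cK : #|K| + 3 = #|S|.
  by rewrite (cardsD1 p S) pS (cardsD1 q (S :\ p)) q' (cardsD1 r (S :\ p :\ q)) r' /K;
    clear; lia.
have zK : z \in K by rewrite !inE zS nzr nzq eq_sym npz.
split=> //.
- by split=> //; rewrite /K !inE eqxx ?andbF.
- apply: triangle_freeS f2; apply/subsetP => x; rewrite !inE => /orP[/eqP->|/and4P[->
  _ -> ->]] //.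
  by rewrite nqr eq_sym npq.
- apply: triangle_freeS f1; apply/subsetP => x; rewrite !inE => /orP[/eqP->|/and4P[_ ->
  -> ->]] //.
  by rewrite eq_sym nqr eq_sym npr.
- by split=> //; rewrite pair_degC; clear -t1 cK; rewrite -/K in t1; lia.
- by move: cK; rewrite (cardsD1 z K) zK; clear; lia.
Qed.

(* If [r] and [q] were beyond opposite ends of [K], then [z] would be an end of
   [K], so it would have an inner place with respect to one of [r], [q] and be
   an end with respect to the other; [p] would then have to be on both sides of
   the remaining points. *)
Lemma not_opposite S p z q r pos h g : config S p z q r -> 8 < #|S| ->
  let K := S :\ p :\ q :\ r in
  ordered K pos -> cut K pos h r -> cut K pos g q -> opposite K pos h g r q -> False.
Proof.
move=> cf cS K; have KE : K = S :\ p :\ q :\ r by [].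
clearbody K => o cr cq [lh [k1 [k2 [[k1K k2K n12] [m1 m2 b1 b2 col]]]]].
have [[zK cK pK qK rK] fq fr [nqr tK] cJ] := config_facts cf cS.
rewrite -KE in zK cK pK qK rK fq fr tK cJ.
have nqrz : ~~ noncol r q z by case: cf => _ _ _ [_ + _ _] _; rewrite noncol_swap.
have [j1 [j2 [j1J j2J l12]]] : exists j1 j2, [/\ j1 \in K :\ z,
  j2 \in K :\ z & pos j1 < pos j2].
  have : 1 < #|K :\ z| by clear -cJ cS; lia.
  case/card_gt1P=> a [b [aJ bJ nab]].
  case: (ltngtP (pos a) (pos b)) => e; [by exists a, b|by exists b, a|].
  move: aJ bJ; rewrite !inE => /andP[_ aK] /andP[_ bK].
  by case/eqP: nab; apply: (o.1 _ _ aK bK).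
have oJ : between j1 j2 j2 by apply: between_refl2.
(* For either choice of [c], the points [z] and [p] enter [c |: (K :\ z)] tightly, so they share a
   gap or lie at opposite ends; [P] is the doubled order of [ordered_insert]. *)
have opz c hc P : (c = r \/ c = q) -> cut K pos hc c ->
  P = (fun x => if x == c then hc.*2 else (pos x).*2.+1) -> exists g',
    [/\ cut (c |: (K :\ z)) P g' p &
     [\/ same_gap (c |: (K :\ z)) P (P z) g' z p, opposite (c |: (K :\ z)) P (P z) g' z p
     | opposite (c |: (K :\ z)) P g' (P z) p z]].
  move=> hcc cc PE.
  have cK' : c \notin K by case: hcc => ->.
  have oc := ordered_insert o cK' cc; rewrite -PE in oc.
  have zc : z != c by apply: contraNneq cK' => <-.
  have e : c |: (K :\ z) = (c |: K) :\ z.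
    by apply/setP => x; rewrite !inE; case: eqP => // ->; rewrite eq_sym zc.
  have cz := ordered_cut oc (setU1r c zK); rewrite -e in cz.
  have oc' : ordered (c |: (K :\ z)) P by apply: orderedS oc; rewrite e subD1set.
  have cz' : #|c |: K :\ z| = #|K :\ z| + 1.
    by rewrite cardsU1 !inE (negPf cK') andbF addnC.
  have zn : z \notin c |: (K :\ z) by rewrite !inE (negPf zc) eqxx.
  have [pn fp tp] : [/\ p \notin c |: (K :\ z), triangle_free (p |: (c |: (K :\ z)))
     & pair_deg (c |: (K :\ z)) z p + 2 = #|c |: K :\ z|].
    have [[pS zS qS rS] npz npq npr [nzq nzr _]] := config_mem cf.
    case: cf => _ _ [f1 f2 f3 f4] _ [t1 t2 t3 t4].
    have npc : p != c by case: hcc => ->.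
    split.
    - by rewrite !inE (negPf npc) (negPf pK) andbF.
    - case: hcc => ec; subst c.
        rewrite KE; apply: triangle_freeS f3; apply/subsetP => x; rewrite !inE =>
          /or3P[/eqP->|/eqP->|].
        + by rewrite npq npz pS.
        + by rewrite (eq_sym r) nqr (eq_sym r) nzr rS.
        + by case/and5P=> -> _ -> _ ->.
      rewrite KE; apply: triangle_freeS f4; apply/subsetP => x; rewrite !inE =>
        /or3P[/eqP->|/eqP->|].
      + by rewrite npr npz pS.
      + by rewrite nqr (eq_sym q) nzq qS.
      + by case/and5P=> -> -> _ _ ->.
    - rewrite cz'; case: hcc => ec; subst c.
        have -> : r |: K :\ z = S :\ q :\ p :\ z.
          apply/setP => x; rewrite KE !inE; have [->|] := eqVneq x r; last first.
            by case: (x == z); case: (x == q); case: (x == p).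
          by rewrite (eq_sym r z) nzr (eq_sym r p) npr (eq_sym r q) nqr rS.
        by rewrite pair_degC; clear -t3 cJ; lia.
      have -> : q |: K :\ z = S :\ r :\ p :\ z.
        apply/setP => x; rewrite KE !inE; have [->|] := eqVneq x q; last first.
          by case: (x == z); case: (x == r); case: (x == p).
        by rewrite (eq_sym q z) nzq (eq_sym q p) npq nqr qS.
      by rewrite pair_degC; clear -t4 cJ; lia.
  have h4 : 3 < #|c |: K :\ z| by rewrite cz'; clear -cJ cS; lia.
  have nzp : z != p by apply: contraNneq pK => <-.
  have [g' cp] := triangle_free_cut oc' h4 fp pn.
  exists g'; split=> //.
  case: (insert_pair_struct oc' cz cp zn pn nzp) => [t0|[_ H]];
    first by clear -t0 tp h4; lia.
  by apply: H; rewrite tp.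
pose P1 x := if x == r then h.*2 else (pos x).*2.+1.
pose P2 x := if x == q then g.*2 else (pos x).*2.+1.
have [g1 [c1 s1]] := opz r h P1 (or_introl erefl) cr erefl.
have [g2 [c2 s2]] := opz q g P2 (or_intror erefl) cq erefl.
have E1 x : x \in K -> P1 x = (pos x).*2.+1.
  by move=> xK; rewrite /P1; case: eqP => // e; move: rK; rewrite -e xK.
have E2 x : x \in K -> P2 x = (pos x).*2.+1.
  by move=> xK; rewrite /P2; case: eqP => // e; move: qK; rewrite -e xK.
have Er : P1 r = h.*2 by rewrite /P1 eqxx.
have Eq : P2 q = g.*2 by rewrite /P2 eqxx.
clearbody P1 P2.
have [_ zx] : z = z /\ (z = k1 \/ z = k2) by split=> //; apply: col.
have J x : x \in K :\ z -> x \in K by rewrite inE => /andP[].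
have r1 : r \in r |: K :\ z by rewrite setU11.
have q1 : q \in q |: K :\ z by rewrite setU11.
have J1 x : x \in K :\ z -> x \in r |: K :\ z by apply: setU1r.
have J2 x : x \in K :\ z -> x \in q |: K :\ z by apply: setU1r.
have [hz gz] := lh z zK; have [hj1 gj1] := lh j1 (J _ j1J); have [hj2 gj2] :=
  lh j2 (J _ j2J).
have zj x : x \in K :\ z -> pos x != pos z.
  by move=> xJ; have := xJ; rewrite in_setD1 => /andP[/eqP n xK]; apply/eqP =>
    /(o.1 _ _ xK zK).
have e1z := E1 z zK; have e2z := E2 z zK.
have e1j1 := E1 _ (J _ j1J); have e1j2 := E1 _ (J _ j2J).
have e2j1 := E2 _ (J _ j1J); have e2j2 := E2 _ (J _ j2J).
have np x : x \in K -> x != p by move=> xK; apply: contraNneq pK => <-.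
have nj : j1 != j2 by apply: contraTneq l12 => ->; rewrite ltnn.
have P1j : P1 j1 < P1 j2 by rewrite e1j1 e1j2; clear -l12; lia.
have P2j : P2 j1 < P2 j2 by rewrite e2j1 e2j2; clear -l12; lia.
have contra : between p j1 j2 -> between j1 j2 p -> False.
  by move=> a1 a2; have n1 := np _ (J _ j1J); have n2 := np _ (J _ j2J); between_auto.
have zj1 := zj _ j1J; have zj2 := zj _ j2J.
have [lo1 hi1 mid1] := c1; have [lo2 hi2 mid2] := c2.
(* Seen together with [r], [p] precedes [j1] and [j2]; seen together with [q], it follows them. Both
   hold whichever end of [K] is [z]. *)
have q12 : g1 <= P1 j1 /\ P2 j2 < g2.
  case: zx => ez.
    have mz x : x \in K :\ z -> pos z < pos x.
      move=> xJ; rewrite ltn_neqAle eq_sym zj //= ez; apply: m1; exact: J.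
    split.
      case: s1 => [[s _]|[s _]|[s _]].
      - by rewrite leqNgt -(s _ (J1 _ j1J)) e1z e1j1; have := mz _ j1J; clear; lia.
      - by have := s _ r1; clear -e1z Er hz; lia.
      - by have := s _ (J1 _ j1J); have := mz _ j1J; clear -e1z e1j1; lia.
    case: s2 => [[s [x1 [x2 [[x1J x2J l1 l2] _]]]]|[s _]|[s _]].
    - exfalso; move: x1J l1; rewrite in_setU1 => /orP[/eqP->|x1J].
        by clear -Eq e2z gz; lia.
      have := mz _ x1J; have := E2 _ (J _ x1J); clear -e2z; lia.
    - by have [] := s _ (J2 _ j2J).
    - by have := s _ (J2 _ j1J); have := mz _ j1J; clear -e2z e2j1; lia.
  have mz x : x \in K :\ z -> pos x < pos z.
    move=> xJ; rewrite ltn_neqAle zj //= ez; apply: m2; exact: J.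
  split.
    case: s1 => [[s [x1 [x2 [[x1J x2J l1 l2] _]]]]|[s _]|[s _]].
    - exfalso; move: x2J l2; rewrite in_setU1 => /orP[/eqP->|x2J].
        by clear -Er e1z hz; lia.
      have := mz _ x2J; have := E1 _ (J _ x2J); clear -e1z; lia.
    - by have := s _ (J1 _ j1J); have := mz _ j1J; clear -e1z e1j1; lia.
    - by have [] := s _ (J1 _ j1J).
  case: s2 => [[s _]|[s _]|[s _]].
  - by rewrite -(s _ (J2 _ j2J)) e2z e2j2; have := mz _ j2J; clear; lia.
  - by have := s _ (J2 _ j1J); have := mz _ j1J; clear -e2z e2j1; lia.
  - by have := s _ q1; clear -e2z Eq gz; lia.
case: q12 => a1 a2; apply: contra.
  by apply: hi1 => //; [exact: J1|exact: J1].
by apply: lo2 => //; [exact: J2|exact: J2].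
Qed.

Definition next_to (u v : nat) := (u == v.+1) || (v == u.+1).

(** The tight count puts [q] into the gap of [r], as opposite ends are excluded. The positions of
    [K] are all values below [N] except [h], so the ends of the gap are at [h.-1] and [h.+1], and
    [q] may share the position [h] of [r]. *)
Lemma twin_gap S p z q r pos h N : config S p z q r -> 8 < #|S| ->
  forall K, K = S :\ p :\ q :\ r ->
  ordered K pos -> cut K pos h r ->
  (forall k, k \in K -> pos k < N /\ pos k != h) ->
  (forall v, v < N -> v != h -> exists2 k, k \in K & pos k = v) ->
  [/\ cut K pos h q, 0 < h, h.+1 < N,
      forall k, k \in K -> next_to (pos k) h -> between r k q &
      forall k, k \in K -> ~~ noncol r q k -> next_to (pos k) h].
Proof.
move=> cf cS K KE o cr bnd full.
have [[zK cK pK qK rK] fq fr [nqr tK] cJ] := config_facts cf cS.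
rewrite -KE in zK cK pK qK rK fq fr tK cJ.
have K4 : 3 < #|K| by clear -cK cS; lia.
have [g cq] := triangle_free_cut o K4 fq qK.
have nrq : r != q by rewrite eq_sym.
case: (insert_pair_struct o cr cq rK qK nrq) => [t0|[_ H]]; first by clear -t0 tK K4; lia.
case: H; [by rewrite tK|move=> H|move=> H|move=> H].
- case: H => s [k1 [k2 [[k1K k2K l1 l2] [m1 m2 b1 b2 col]]]].
  have [lt2 ne2] := bnd _ k2K; have [lt1 _] := bnd _ k1K.
  have p1 : pos k1 = h.-1.
    have [||y yK hy] := full h.-1; [clear -l2 lt2; lia|clear -l1; lia|].
    have := m1 y yK; rewrite hy; clear -l1; lia.
  have p2 : pos k2 = h.+1.
    have [||y yK hy] := full h.+1; [clear -l2 lt2 ne2; lia|clear; lia|].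
    have := m2 y yK; rewrite hy; clear -l2 ne2; lia.
  have inj x y : x \in K -> y \in K -> pos x = pos y -> x = y by apply: o.1.
  split.
  - case: cq => lo hi mid; split=> x y xK yK.
    + by move=> l3 l4; apply: lo; rewrite -?s.
    + by move=> l3 l4; apply: hi => //; rewrite leqNgt -s // -leqNgt.
    + by move=> l3 l4; apply: mid => //; [rewrite -s|rewrite leqNgt -s // -leqNgt].
  - by clear -l1; lia.
  - by rewrite -p2.
  - move=> k kK /orP[/eqP e|/eqP e].
      by rewrite (inj k k2) // e p2.
    by rewrite (inj k k1) // p1 e.
  - move=> k kK /(col k kK)[] ->; rewrite /next_to ?p1 ?p2 ?eqxx //.
    by clear -l1; lia.
- by exfalso; move: o cr cq H; rewrite KE => o cr cq H;
  exact: (not_opposite cf cS o cr cq H).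
- exfalso; move: o cr cq H; rewrite KE (setD1C (S :\ p) q r) => o cr cq H.
  exact: (not_opposite (config_symr cf) cS o cq cr H).
Qed.

End Positions.

(* Distance between positions, with value [e] for two points at one position. *)
Definition twin_dist (T : eqType) (pos : T -> nat) (e : nat) (x y : T) : nat :=
  if x == y then 0 else if pos x == pos y then e else (pos x - pos y) + (pos y - pos x).

(** * Betweenness read off a distance between positions *)

Section Model.

Variable B : betweenness.
Local Notation X := (point B).
Implicit Types (x y z w k p q r a b c : X) (S K : {set X}).

Definition ranked S (P : X -> nat) N :=
  [/\ ordered S P, forall x, x \in S -> P x < N &
      forall v, v < N -> exists2 x, x \in S & P x = v].

Lemma ordered_twin K (P : X -> nat) q : ordered K P -> cut K P (P q) q ->
  (forall k, k \in K -> P k != P q) -> ordered (q |: K) P.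
Proof.
move=> [inj ord] [lo hi mid] ne.
split=> [x y|x y z].
  rewrite !in_setU1 => /orP[/eqP->|xK] /orP[/eqP->|yK] e //.
  - by have := ne y yK; rewrite e eqxx.
  - by have := ne x xK; rewrite e eqxx.
  - exact: inj.
rewrite !in_setU1 => /orP[/eqP->|xK] /orP[/eqP->|yK] /orP[/eqP->|zK];
  rewrite ?ltnn // => l1 l2.
- by have := ltn_trans l1 l2; rewrite ltnn.
- by apply: hi => //; exact: ltnW.
- by apply: mid => //; exact: ltnW.
- by apply: lo.
- exact: ord.
Qed.

(** Exchanging the twins [r] and [q] preserves the ranking. Repeated through the symmetries of
    [config], this reaches all four ways of deleting one point of each pair. *)
Lemma twin_step S p z q r P N : config S p z q r -> 8 < #|S| -> P q = P r ->
  ranked (S :\ p :\ q) P N ->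
  [/\ ranked (S :\ p :\ r) P N, 0 < P r, (P r).+1 < N,
      forall k, k \in S :\ p :\ q :\ r -> next_to (P k) (P r) -> between r k q &
      forall k, k \in S :\ p :\ q :\ r -> ~~ noncol r q k -> next_to (P k) (P r)].
Proof.
move=> cf cS ePqr [o bnd full].
have [[pS zS qS rS] npz npq npr [nzq nzr nqr]] := config_mem cf.
have rL : r \in S :\ p :\ q by rewrite !inE rS !(eq_sym r) npr nqr.
have KL x : x \in S :\ p :\ q :\ r -> x \in S :\ p :\ q /\ x != r.
  by rewrite in_setD1 => /andP[].
have oK : ordered (S :\ p :\ q :\ r) P by apply: orderedS o; apply: subD1set.
have ne k : k \in S :\ p :\ q :\ r -> P k != P r.
  by move=> /KL[kL nkr]; apply: contraNneq nkr => /(o.1 _ _ kL rL) ->.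
have [||cq r0 rN b1 b2] := twin_gap (N := N) cf cS erefl oK (ordered_cut o rL).
- by move=> k kK; split; [apply: bnd; case: (KL k kK)|apply: ne].
- move=> v lv nv; have [x xL ex] := full v lv; exists x => //.
  by rewrite in_setD1 xL andbT; apply: contraNneq nv => <-; rewrite ex.
have e : S :\ p :\ r = q |: (S :\ p :\ q :\ r).
  rewrite setD1C [S :\ p :\ q :\ r](_ : _ = S :\ r :\ p :\ q) ?setD1K //.
    by rewrite !inE qS nqr eq_sym npq.
  by rewrite setD1C (setD1C S p r).
split=> //; split.
- by rewrite e; apply: ordered_twin; rewrite // ePqr.
- move=> x; rewrite e in_setU1 => /orP[/eqP->|/KL[xL _]]; last exact: bnd.
  by rewrite ePqr; apply: bnd.
- move=> v lv; have [x xL ex] := full v lv.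
  have [exr|nxr] := eqVneq x r.
    by exists q; rewrite ?e ?setU11 // ePqr -exr.
  by exists x => //; rewrite e in_setU1 in_setD1 nxr xL orbT.
Qed.

(* The points [z], [r] and the rest form a path, [p] doubles [z] and [q]
   doubles [r]; positions are counted from 0. *)
Definition model (P : X -> nat) (N i : nat) p z q r :=
  [/\ uniq [:: p; z; q; r], [/\ P p = i, P z = i, P q = i.+1 & P r = i.+1],
      forall x y w, between x y w = (twin_dist P 2 x w == twin_dist P 2 x y + twin_dist P
        2 y w),
      (forall x, P x < N) /\ (forall v, v < N -> exists x, [/\ P x = v,
        x != p & x != q]) &
      [/\ 0 < i, i.+2 < N & #|X| = N + 2]].

Lemma between_xyx x y : x != y -> between x y x = false.
Proof.
move=> n; apply/negP => h; have := between_anti h (between_refl2 y x).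
by apply/eqP.
Qed.

Lemma between_mid_uniq x y w : between x y w -> x != y -> y != w -> x != w ->
  [/\ between y x w = false, between x w y = false,
    between w x y = false & between y w x = false].
Proof.
move=> h n1 n2 n3; rewrite (between_symE w x y) (between_symE y w x).
suff [-> ->] : between y x w = false /\ between x w y = false by [].
by split; apply/negP => h'; saturate.
Qed.

(** For twins as ends, [2 = 1 + 1] holds just for neighbouring middle points. A twin of an end is
    never the middle: if the three points are collinear, the third is a neighbour and lies between
    the twins. *)
Lemma twin_btE (P : X -> nat) :
  (forall x y w, P x < P y -> P y < P w -> between x y w) ->
  (forall x w y, x != w -> P x = P w -> y != x -> y != w ->
     P y != P x /\ (next_to (P y) (P x) -> between x y w) /\ (~~ noncol x w y ->
       next_to (P y) (P x))) ->
  forall x y w, between x y w = (twin_dist P 2 x w == twin_dist P 2 x y + twin_dist P 2 y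
    w).
Proof.
move=> al be x y w; rewrite /twin_dist.
have [->|nxy] := eqVneq x y; first by rewrite between_refl add0n eqxx.
have [e|nyw] := eqVneq y w.
  by rewrite -e (negPf nxy) between_refl2 addn0 eqxx.
have [<-|nxw] := eqVneq x w.
  rewrite between_xyx // (eq_sym (P y)); case: (eqVneq (P x) (P y)) => // e.
  by apply/esym/negbTE; move: e; clear; lia.
have nyx : y != x by rewrite eq_sym.
have nwy : w != y by rewrite eq_sym.
have nwx : w != x by rewrite eq_sym.
have [exw|dxw] := eqVneq (P x) (P w).
  have [dyx [b1 b2]] := be x w y nxw exw nyx nyw.
  rewrite -exw (eq_sym (P x) (P y)) (negPf dyx).
  have -> : between x y w = next_to (P y) (P x).
    apply/idP/idP => [h|/b1//]; apply: b2.
    by rewrite noncol_swapr; apply/negP; rewrite (between_noncol h).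
  by rewrite /next_to; move: dyx; clear; lia.
have [exy|dxy] := eqVneq (P x) (P y).
  have [_ [b1 b2]] := be x y w nxy exy nwx nwy.
  have -> : between x y w = false.
    apply/negP => h; have h2 : ~~ noncol x y w by rewrite (between_noncol h).
    have := b1 (b2 h2) => h3; saturate.
  by rewrite -exy ?(negPf dxw); apply/esym/negbTE; clear; lia.
have [eyw|dyw] := eqVneq (P y) (P w).
  have [_ [b1 b2]] := be y w x nyw eyw nxy nxw.
  have -> : between x y w = false.
    apply/negP => h; have h2 : ~~ noncol y w x by rewrite -noncol_rot (between_noncol h).
    have := b1 (b2 h2) => h3; saturate.
  by rewrite eyw; apply/esym/negbTE; clear; lia.
have sol (b : bool) (Q : bool) : b -> Q -> b = Q by move=> -> ->.
have sol' (b : bool) (Q : bool) : b = false -> ~~ Q -> b = Q by move=> -> /negbTE->.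
case: (ltngtP (P x) (P y)) dxy => l1 // _; case: (ltngtP (P y) (P w)) dyw => l2 // _.
- by apply: sol; [apply: al|move: l1 l2; clear; lia].
- case: (ltngtP (P x) (P w)) dxw => l3 // _.
    have h := al _ _ _ l3 l2; have [_ e _ _] := between_mid_uniq h nxw nwy nxy.
    by apply: sol'; [rewrite e|move: l1 l2 l3; clear; lia].
  have h := al _ _ _ l3 l1; have [e _ _ _] := between_mid_uniq h nwx nxy nwy.
  by apply: sol'; [rewrite between_symE;
    case: (between_mid_uniq h nwx nxy nwy)|move: l1 l2 l3; clear; lia].
- case: (ltngtP (P x) (P w)) dxw => l3 // _.
    have h := al _ _ _ l1 l3; have [e _ _ _] := between_mid_uniq h nyx nxw nyw.
    by apply: sol'; [rewrite e|move: l1 l2 l3; clear; lia].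
  have h := al _ _ _ l2 l3; have [_ e _ _] := between_mid_uniq h nyw nwx nyx.
  by apply: sol'; [case: (between_mid_uniq h nyw nwx nyx)|move: l1 l2 l3; clear; lia].
- by apply: sol; [rewrite between_symE; apply: al|move: l1 l2; clear; lia].
Qed.

End Model.

Section ConfigModel.

Variable B : betweenness.
Local Notation X := (point B).
Implicit Types (x y z w k p q r a b c : X) (S K : {set X}).

Lemma config_model p z q r : config [set: X] p z q r -> 8 < #|X| ->
  exists P i, model P (#|X| - 2) i p z q r \/ model P (#|X| - 2) i q r p z.
Proof.
rewrite -cardsT => cf cS.
have [[pS zS qS rS] npz npq npr [nzq nzr nqr]] := config_mem cf.
set S := [set: X] in cf cS pS zS qS rS *.
have inS x : x \in S by rewrite inE.
pose L := S :\ p :\ q; pose N := #|S| - 2.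
have cL : #|L| = N.
  rewrite /N (cardsD1 p S) pS (cardsD1 q (S :\ p)) in_setD1 qS eq_sym npq /L; clear; lia.
have fL : triangle_free L by case: cf => _ _ [].
have [|P0 o0] := triangle_free_ordered fL; first by rewrite cL /N; clear -cS; lia.
have [P1 [o1 bnd1 full1]] := ordered_rank o0.
pose P x := if x == p then P1 z else if x == q then P1 r else P1 x.
have Ppz : P p = P z by rewrite /P eqxx (eq_sym z p) (negPf npz) (negPf nzq).
have Pqr : P q = P r.
  by rewrite /P (eq_sym q p) (negPf npq) eqxx (eq_sym r p) (negPf npr) (eq_sym r q)
    (negPf nqr).
have PL x : x \in L -> P x = P1 x.
  by rewrite !in_setD1 /P => /and3P[/negPf -> /negPf ->].
have rk : ranked (S :\ p :\ q) P N.
  rewrite -/L; split.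
  - split=> [x y xL yL|x y w xL yL wL]; rewrite !PL //; first exact: o1.1.
    exact: o1.2.
  - by move=> x xL; rewrite PL // -cL; apply: bnd1.
  - by move=> v; rewrite -cL => /full1[x xL e]; exists x; rewrite ?PL.
have [rk2 r0 rN b1 b1'] := twin_step cf cS Pqr rk.
rewrite (setD1C S p q) in rk.
have [rk3 z0 zN b2 b2'] := twin_step (config_swap cf) cS Ppz rk.
rewrite (setD1C S p r) in rk2.
have [rk4 _ _ b3 b3'] := twin_step (config_syml (config_swap cf)) cS Ppz rk2.
rewrite (setD1C S q z) in rk3; rewrite (setD1C S r z) in rk4.
have [_ _ _ b4 b4'] := twin_step (config_syml cf) cS Pqr rk3.
rewrite (setD1C S q p) in rk; rewrite (setD1C S r p) in rk2.
have mem x a b : x != a -> x != b -> x \in S :\ a :\ b by move=> n1 n2;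
  rewrite !in_setD1 n1 n2 inS.
have [[[i1 or1] [i2 or2]] [[i3 or3] [i4 or4]]] :
  (ordered (S :\ p :\ q) P /\ ordered (S :\ p :\ r) P) /\
  (ordered (S :\ z :\ q) P /\ ordered (S :\ z :\ r) P).
  by case: rk => ? _ _; case: rk2 => ? _ _; case: rk3 => ? _ _; case: rk4 => ? _ _.
(* Points at three distinct positions avoid one twin of each pair, so they lie in one of the four
   ordered sets. *)
have al x y w : P x < P y -> P y < P w -> between x y w.
  move=> l1 l2; have l3 := ltn_trans l1 l2.
  have sep a b : a != b -> P a = P b -> [&& x != a, y != a & w != a] || [&& x != b,
    y != b & w != b].
    move=> nab eab; apply: contraT; rewrite negb_or !negb_and !negbK.
    by case/andP=> /or3P[]/eqP e1 /or3P[]/eqP e2; subst; move: l1 l2 l3 nab;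
      rewrite ?eqxx // ?eab ?ltnn.
  have /orP[/and3P[? ? ?]|/and3P[? ? ?]] := sep _ _ npz Ppz;
  have /orP[/and3P[? ? ?]|/and3P[? ? ?]] := sep _ _ nqr Pqr;
  [apply: or1|apply: or2|apply: or3|apply: or4] => //; exact: mem.
have tw x w : x != w -> P x = P w ->
  [\/ x = p /\ w = z, x = z /\ w = p, x = q /\ w = r | x = r /\ w = q].
  move=> nxw e.
  have sep a b : a != b -> [\/ x = a /\ w = b,
    x = b /\ w = a | (x != a /\ w != a) \/ (x != b /\ w != b)].
    move=> nab; have [exa|nxa] := eqVneq x a; have [ewb|nwb] := eqVneq w b.
    - by constructor 1.
    - constructor 3; right; split=> //; first by rewrite exa.
    - constructor 3; left; split=> //; first by rewrite ewb eq_sym.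
    have [exb|nxb] := eqVneq x b; have [ewa|nwa] := eqVneq w a; try by constructor 3;
      auto.
    by constructor 2.
  case: (sep _ _ npz) => [h|h|h1]; [by constructor 1|by constructor 2|].
  case: (sep _ _ nqr) => [h|h|h2]; [by constructor 3|by constructor 4|].
  case/eqP: nxw; case: h1 => -[? ?]; case: h2 => -[? ?].
  - by apply: i1 => //; apply: mem.
  - by apply: i2 => //; apply: mem.
  - by apply: i3 => //; apply: mem.
  - by apply: i4 => //; apply: mem.
have Npz y : y != p -> y != z -> P y != P p.
  move=> n1 n2; apply/eqP => /(tw _ _ n1)[] [e1 e2].
  - by rewrite e1 eqxx in n1.
  - by rewrite e1 eqxx in n2.
  - by rewrite e2 eqxx in npr.
  - by rewrite e2 eqxx in npq.
have Nqr y : y != q -> y != r -> P y != P q.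
  move=> n1 n2; apply/eqP => /(tw _ _ n1)[] [e1 e2].
  - by rewrite e2 eqxx in nzq.
  - by rewrite e2 eqxx in npq.
  - by rewrite e1 eqxx in n1.
  - by rewrite e1 eqxx in n2.
have Bpz y : y != p -> y != z -> (next_to (P y) (P z) ->
  between z y p) /\ (~~ noncol z p y -> next_to (P y) (P z)).
  move=> n1 n2; have [e|nyq] := eqVneq y q.
    have yK : y \in S :\ r :\ p :\ z by rewrite in_setD1 n2 mem ?n1 // e.
    by split=> h; [apply: b3|apply: b3'].
  have yK : y \in S :\ q :\ p :\ z by rewrite in_setD1 n2 mem.
  by split=> h; [apply: b2|apply: b2'].
have Bqr y : y != q -> y != r -> (next_to (P y) (P r) ->
  between r y q) /\ (~~ noncol r q y -> next_to (P y) (P r)).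
  move=> n1 n2; have [e|nyp] := eqVneq y p.
    have yK : y \in S :\ z :\ q :\ r by rewrite in_setD1 n2 mem ?n1 // e.
    by split=> h; [apply: b4|apply: b4'].
  have yK : y \in S :\ p :\ q :\ r by rewrite in_setD1 n2 mem.
  by split=> h; [apply: b1|apply: b1'].
have E := twin_btE al.
have {}E x y w : between x y w = (twin_dist P 2 x w == twin_dist P 2 x y + twin_dist P 2
  y w).
  apply: E => {x y w} x w y nxw e nyx nyw.
  case: (tw x w nxw e) => -[ex ew]; subst x w.
  - have [h1 h2] := Bpz y nyx nyw; split; first exact: Npz.
    by split; [rewrite between_symE Ppz|rewrite noncol_swap Ppz].
  - have [h1 h2] := Bpz y nyw nyx; split; first by rewrite -Ppz Npz.
    by split.
  - have [h1 h2] := Bqr y nyx nyw; split; first exact: Nqr.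
    by split; [rewrite between_symE Pqr|rewrite noncol_swap Pqr].
  - have [h1 h2] := Bqr y nyw nyx; split; first by rewrite -Pqr Nqr.
    by split.
(* Since [q], [r], [z] are collinear, the two twin positions are consecutive; which of them is lower
   decides between the two alternatives. *)
have zr : next_to (P z) (P r).
  apply: (Bqr z nzq nzr).2; case: cf => _ _ _ [_ h _ _] _; by rewrite noncol_swap.
have [_ bnd full] := rk.
have bndX x : P x < N.
  have [->|xp] := eqVneq x p; first by rewrite Ppz; apply: bnd; apply: mem;
    rewrite // eq_sym.
  have [->|xq] := eqVneq x q; last by apply: bnd; apply: mem.
  by rewrite Pqr; apply: bnd; apply: mem; rewrite eq_sym.
have cX : #|X| = N + 2 by rewrite /N -cardsT -/S; clear -cS; lia.
have [_ _ full2] := rk.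
case/orP: zr => /eqP e.
  exists P, (P r); right; split=> //.
  - by rewrite /= !inE !negb_or nqr (eq_sym q) npq (eq_sym q) nzq (eq_sym r) npr (eq_sym
    r) nzr npz.
  - by split; rewrite ?Pqr ?Ppz.
  - split=> // v /full[x]; rewrite !in_setD1 => /and3P[x1 x2 _] ex; by exists x.
  - by split=> //; rewrite -e.
exists P, (P z); left; split=> //.
- by rewrite /= !inE !negb_or npz npq npr nzq nzr nqr.
- by split; rewrite ?Ppz ?Pqr.
- split=> // v /full[x]; rewrite !in_setD1 => /and3P[x1 x2 _] ex; by exists x.
- by split=> //; rewrite -e.
Qed.

(** Reversal sends the twin positions [i] and [i.+1] to [N - i.+1] and [N - i.+2]; the second is now
    the lower one, so the pairs exchange roles. *)
Lemma model_flip P N i p z q r : model P N i p z q r ->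
  model (fun x => N.-1 - P x) N (N - i.+2) q r p z.
Proof.
case=> u [e1 e2 e3 e4] E [bnd full] [i0 iN cX].
have b x : P x < N := bnd x.
split.
- move: u; rewrite /= !inE !negb_or !andbT (eq_sym q p) (eq_sym q z) (eq_sym r p) (eq_sym
  r z).
  by case/and3P=> /and3P[-> -> ->] /andP[-> ->] ->.
- by rewrite e1 e2 e3 e4; clear -i0 iN; split; lia.
- have dE x y : twin_dist (fun x => N.-1 - P x) 2 x y = twin_dist P 2 x y.
    rewrite /twin_dist; case: eqP => // _; have := b x; have := b y; clear.
    by case: eqP; case: eqP; lia.
  by move=> x y w; rewrite E !dE.
- split=> [x|v lv]; first by have := b x; clear; lia.
  have n1 : N.-1 - v < N by clear -lv; lia.
  have [x [ex xp xq]] := full _ n1; exists x; split=> //; rewrite ex; clear -lv; lia.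
- by clear -i0 iN cX; split; lia.
Qed.

End ConfigModel.

(** * The structures T_(n,i) *)

Section GraphTwin.

Variables (T : finType) (e : rel T) (pos : T -> nat) (N : nat).
Hypothesis eE : forall x y, e x y = next_to (pos x) (pos y).
Hypothesis bnd : forall x, pos x < N.
Hypothesis full : forall v, v < N -> exists x, pos x = v.
Hypothesis N2 : 1 < N.
Hypothesis NT : N <= #|T|.

Lemma walk_lower x p : path e x p ->
  pos x <= pos (last x p) + size p /\ pos (last x p) <= pos x + size p.
Proof.
elim: p x => [|a p IH] x /=; first by lia.
by rewrite eE /next_to => /andP[h /IH]; lia.
Qed.

Lemma walk_up k x y : pos y = pos x + k.+1 -> walk e k.+1 x y.
Proof.
elim: k x => [|k IH] x h; apply/walkP.
  by exists [:: y]; split=> //=; rewrite eE /next_to h andbT; lia.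
have [|u hu] := full (v := (pos x).+1); first by have := bnd y; lia.
have /walkP[p [sp ep lp]] : walk e k.+1 u y by apply: IH; lia.
exists (u :: p); split=> //=; first by rewrite sp.
by rewrite ep eE /next_to hu eqxx orbT.
Qed.

(** Each edge changes the position by exactly 1. Two points at one position are not adjacent but
    have a common neighbour, because [N > 1]; this is the value 2. *)
Lemma gdist_twin_dist x y : gdist e x y = twin_dist pos 2 x y.
Proof.
have es : symmetric e by move=> a b; rewrite !eE /next_to orbC.
rewrite /twin_dist; have [->|nxy] := eqVneq x y; first exact: gdist_refl.
have lower : gdist e x y < #|T| ->
  (if pos x == pos y then 2 else (pos x - pos y) + (pos y - pos x)) <= gdist e x y.
  move=> /gdist_walk/walkP[p [sp ep lp]]; rewrite -sp.
  have := walk_lower ep; rewrite lp => h.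
  case: eqP => // exy; last by lia.
  case: p sp ep lp {h} => [|a [|//]] /= _.
    by move=> _ e0; rewrite e0 eqxx in nxy.
  rewrite andbT => ea ay; move: ea; rewrite ay eE /next_to exy; lia.
have upper : gdist e x y <= (if pos x == pos y then 2 else (pos x - pos y) + (pos y - pos
  x)).
  apply: gdist_le; case: (ltngtP (pos x) (pos y)) => h.
  - have -> : pos x - pos y + (pos y - pos x) = (pos y - pos x).-1.+1 by lia.
    by apply: walk_up; lia.
  - have -> : pos x - pos y + (pos y - pos x) = (pos x - pos y).-1.+1 by lia.
    by apply: walk_sym => //; apply: walk_up; lia.
  - have [u hu] : exists u, next_to (pos x) (pos u).
      have [l|l] := ltnP (pos x).+1 N.
        by have [u hu] := full l; exists u; rewrite /next_to hu eqxx orbT.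
      have [|u hu] := full (v := (pos x).-1); first by have := bnd x; lia.
      by exists u; rewrite /next_to hu; have := bnd x; lia.
    apply/walkP; exists [:: u; y]; split=> //=.
    by rewrite !eE hu /= andbT /next_to -h orbC.
(* [gdist] takes the default value [#|T|] when no shorter walk exists; the claimed distance is at
   most [N <= #|T|], so the lower bound survives this case. *)
have [l|l] := ltnP (gdist e x y) #|T|.
  by apply/eqP; rewrite eqn_leq upper lower.
apply/eqP; rewrite eqn_leq upper /=; apply: leq_trans l.
by have := bnd x; have := bnd y; case: eqP; lia.
Qed.

End GraphTwin.

Section TModel.

Variables (n i : nat).
Hypothesis n6 : 5 < n.
Hypothesis i0 : 0 < i.
Hypothesis i5 : i <= n - 5.

(** Counted from 0: x_1, ..., x_i take [0] to [i - 1], the two twin pairs take [i] and [i + 1], and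
    x_(i+1) takes [i + 2]. *)
Definition T_pos (a : T_vertex n) : nat :=
  match a with
  | inl j => if j < i then (j : nat) else j.+2
  | inr Qy | inr Qz => i
  | inr Qu | inr Qv => i.+1
  end.

Lemma T_edgeE (a b : T_vertex n) : @T_edge n i a b = next_to (T_pos a) (T_pos b).
Proof.
rewrite /T_edge /next_to; case: a => [j|[]]; case: b => [k|[]] /=;
  by do ?[case: ltnP => ?]; clear n6 i5; lia.
Qed.

Lemma T_pos_lt (a : T_vertex n) : T_pos a < n - 2.
Proof.
case: a => [j|[]] /=; try (clear -n6 i5; lia).
by have := ltn_ord j; case: (ltnP j i); clear -n6 i5; lia.
Qed.

Lemma T_pos_inl v : v < n - 2 -> v != i -> v != i.+1 -> exists j, T_pos (inl j) = v.
Proof.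
move=> lv n1 n2; have [l|l] := ltnP v i.
  have h : v < n - 4 by clear -l i5 n6; lia.
  by exists (Ordinal h); rewrite /= l.
have h : v - 2 < n - 4 by clear -lv l n1 n2 n6; lia.
exists (Ordinal h); rewrite /=; case: (ltnP (v - 2) i); clear -l n1 n2; lia.
Qed.

Lemma T_pos_full v : v < n - 2 -> exists a, T_pos a = v.
Proof.
move=> lv; have [->|n1] := eqVneq v i; first by exists (inr Qy).
have [->|n2] := eqVneq v i.+1; first by exists (inr Qu).
by have [j hj] := T_pos_inl lv n1 n2; exists (inl j).
Qed.

Lemma card_T_vertex : #|T_vertex n| = n.
Proof.
rewrite card_sum card_ord -(card_codom (f := quad_code)); last exact: can_inj quad_codeK.
rewrite (eq_card (B := predT)) => [|b]; first by rewrite card_prod card_bool; clear -n6;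
  lia.
by rewrite inE; apply/codomP; exists (quad_decode b); case: b => [[] []].
Qed.

Lemma T_btwE x y z : between (B := T_betweenness n i) x y z =
  (twin_dist T_pos 2 x z == twin_dist T_pos 2 x y + twin_dist T_pos 2 y z).
Proof.
have g := gdist_twin_dist T_edgeE T_pos_lt T_pos_full.
by rewrite /between graph_btwE !g // ?card_T_vertex; clear -n6; lia.
Qed.

End TModel.

Lemma model_iso (B : betweenness) (P : point B -> nat) N i (p z q r : point B) :
  model P N i p z q r -> isomorphic B (T_betweenness (N + 2) i).
Proof.
case=> u [e1 e2 e3 e4] E [bnd full] [i0 iN cX].
move: u; rewrite /= !inE !negb_or !andbT =>
  /and3P[/and3P[npz npq npr] /andP[nzq nzr] nqr].
have n6 : 5 < N + 2 by clear -i0 iN; lia.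
have i5 : i <= N + 2 - 5 by clear -iN; lia.
(* The representative of position [v] other than the doubling points [p] and [q]; the default [p]
   does not occur for [v < N]. *)
pose F v := odflt p [pick x | (P x == v) && (x != p) && (x != q)].
have FP v : v < N -> P (F v) = v.
  move=> lv; rewrite /F; case: pickP => [x /andP[/andP[/eqP]]//|no].
  by have [x [ex xp xq]] := full v lv; have := no x; rewrite ex xp xq eqxx.
pose h (a : T_vertex (N + 2)) : point B := match a with
  | inl j => F (T_pos i (inl j)) | inr Qy => z | inr Qz => p | inr Qu => r | inr Qv =>
    q end.
have bT (a : T_vertex (N + 2)) : T_pos i a < N by have := T_pos_lt n6 i5 a; rewrite addnK.
have hP a : P (h a) = T_pos i a.
  by case: a => [j|[]] //=; rewrite -/(T_pos i (inl j)) FP // bT.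
have hinj : injective h.
  move=> a b eab; have : T_pos i a = T_pos i b by rewrite -!hP eab.
  case: a b eab => [j|a] [k|b] /=.
  - by move=> _; case: ltnP => ?; case: ltnP => ? ?; congr inl; apply: val_inj => /=;
    pos_lia.
  - by case: b => /= _; case: ltnP => ?; pos_lia.
  - by case: a => /= _; case: ltnP => ?; pos_lia.
  - by case: a; case: b => //= eab h'; exfalso; move: h' npz nqr; rewrite ?eab ?eqxx //;
    clear; lia.
have hbij : bijective h.
  by apply: inj_card_bij hinj _; rewrite card_T_vertex // cX.
have [f fK hK] := hbij.
exists f; split; first by exists h.
move=> x y w; rewrite -/(between x y w) -/(@between (T_betweenness (N + 2) i) (f x) (f y)
  (f w)) E T_btwE //.
have D a b : twin_dist (T_pos i) 2 (f a) (f b) = twin_dist P 2 a b.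
  by rewrite /twin_dist (inj_eq (can_inj hK)) -!hP !hK.
by rewrite !D.
Qed.

(** * Examples *)

Section TwinDist.

Variables (T : finType) (pos : T -> nat) (e : nat).
Hypothesis e12 : 0 < e <= 2.

Lemma twin_dist_refl x : twin_dist pos e x x = 0.
Proof. by rewrite /twin_dist eqxx. Qed.

Lemma twin_dist_sym x y : twin_dist pos e x y = twin_dist pos e y x.
Proof. by rewrite /twin_dist eq_sym (eq_sym (pos x)) addnC. Qed.

Lemma twin_dist_eq0 x y : twin_dist pos e x y = 0 -> x = y.
Proof. by rewrite /twin_dist; case: eqP => // _; case: eqP; clear -e12; lia. Qed.

(** The bound [e <= 2] handles twins [x], [z] with [y] at another position: that detour has length
    at least 2. *)
Lemma twin_dist_triangle x y z : twin_dist pos e x z <= twin_dist pos e x y + twin_dist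
  pos e y z.
Proof.
rewrite /twin_dist; have [->|nxy] := eqVneq x y; first by rewrite add0n.
have [ez|nyz] := eqVneq y z; first by rewrite -ez (negPf nxy) addn0.
have [//|nxz] := eqVneq x z.
by do 3?case: eqP; clear -e12; lia.
Qed.

Definition twin_btw : {set T * T * T} :=
  [set u | twin_dist pos e u.1.1 u.2 == twin_dist pos e u.1.1 u.1.2 + twin_dist pos e
    u.1.2 u.2].

Lemma twin_btwP x y z : ((x, y, z) \in twin_btw) =
  (twin_dist pos e x z == twin_dist pos e x y + twin_dist pos e y z).
Proof. by rewrite inE. Qed.

Lemma twin_P1 x z : (x, x, z) \in twin_btw.
Proof. by rewrite twin_btwP twin_dist_refl. Qed.

Lemma twin_P2 x y z : (x, y, z) \in twin_btw -> (z, y, x) \in twin_btw.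
Proof.
by rewrite !twin_btwP (twin_dist_sym z x) (twin_dist_sym z y) (twin_dist_sym y x) addnC.
Qed.

Lemma twin_P3 x y z : (x, y, z) \in twin_btw -> (y, x, z) \in twin_btw -> x = y.
Proof.
rewrite !twin_btwP (twin_dist_sym y x) => /eqP h1 /eqP h2.
by apply: twin_dist_eq0; clear -h1 h2; lia.
Qed.

Lemma twin_P4 x y z w : (x, y, z) \in twin_btw -> (x, w, y) \in twin_btw ->
  (x, w, z) \in twin_btw /\ (w, y, z) \in twin_btw.
Proof.
rewrite !twin_btwP => /eqP h1 /eqP h2.
have := twin_dist_triangle x w z; have := twin_dist_triangle w y z.
by split; apply/eqP; clear e12; lia.
Qed.

Hypothesis T_nonempty : 0 < #|T|.

Definition twin_betweenness : betweenness :=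
  Betweenness T_nonempty twin_P1 twin_P2 twin_P3 twin_P4.

End TwinDist.

Section TwinStructure.

Variables (B : betweenness) (pos : point B -> nat) (e : nat).
Hypothesis e12 : 0 < e <= 2.
Hypothesis btE : forall x y z, between x y z =
  (twin_dist pos e x z == twin_dist pos e x y + twin_dist pos e y z).

(** Twins are equally far from [z] and [e > 0], so only [z] can be the middle point, at distance
    [e / 2] from both. *)
Lemma twin_noncol x y z : x != y -> pos x = pos y -> pos z != pos x ->
  noncol x y z = (e != 2 * ((pos z - pos x) + (pos x - pos z))).
Proof.
move=> nxy exy nzx; have xz : x != z by apply: contraNneq nzx => ->.
have yz : y != z by apply: contraNneq nzx => <-; rewrite exy.
rewrite /noncol !btE /twin_dist (eq_sym y x) (eq_sym z x) (eq_sym z y).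
rewrite (negPf nxy) (negPf xz) (negPf yz) exy eqxx (eq_sym (pos y)) -exy (negPf nzx).
by clear -e12 nzx; lia.
Qed.

Lemma inj_triangle_free (S : {set point B}) : {in S &, injective pos} -> triangle_free S.
Proof.
move=> inj x y z xS yS zS.
have [->|nxy] := eqVneq x y; first by rewrite noncol_xx.
have [->|nyz] := eqVneq y z; first by rewrite noncol_xyy.
have [->|nxz] := eqVneq x z; first by rewrite noncol_xyx.
have ne a b : a \in S -> b \in S -> a != b -> (pos a == pos b) = false.
  by move=> aS bS; apply: contraNF => /eqP/(inj _ _ aS bS)->.
rewrite /noncol !btE /twin_dist !(eq_sym y x) !(eq_sym z x) !(eq_sym z y).
rewrite (negPf nxy) (negPf nyz) (negPf nxz) !ne // 1?eq_sym //.
by clear; lia.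
Qed.

End TwinStructure.

Lemma co_sizeE (B : betweenness) : co_size B = tri_num [set: point B].
Proof. by apply: eq_card => A; rewrite !inE subsetT andbT. Qed.

Section DoubledLine.

Variables (N c e : nat).
Hypothesis e12 : 0 < e <= 2.

(* [None] doubles the point [c] of a path on [N] points; it extends the path if
   [c = N]. *)
Definition dl_pos (x : option 'I_N) : nat := if x is Some j then (j : nat) else c.

Lemma dl_nonempty : 0 < #|{: option 'I_N}|.
Proof. by apply/card_gt0P; exists None. Qed.

Definition doubled_line : betweenness := twin_betweenness dl_pos e12 dl_nonempty.

Lemma dl_btE (x y z : point doubled_line) : between x y z =
  (twin_dist dl_pos e x z == twin_dist dl_pos e x y + twin_dist dl_pos e y z).
Proof. exact: twin_btwP. Qed.

Lemma card_dl : #|point doubled_line| = N.+1.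
Proof. by rewrite card_option card_ord. Qed.

Lemma dl_triangle_free : triangle_free ([set: point doubled_line] :\ None).
Proof.
apply: (inj_triangle_free dl_btE) => -[x|] [y|]; rewrite !inE //= => _ _ h.
by congr Some; apply: val_inj.
Qed.

Lemma dl_line : N <= c -> co_size doubled_line = 0.
Proof.
move=> Nc; rewrite co_sizeE; apply/tri_num_eq0/(inj_triangle_free dl_btE) =>
  -[x|] [y|] _ _ //= h.
- by congr Some; apply: val_inj.
- by have := ltn_ord x; rewrite h ltnNge Nc.
- by have := ltn_ord y; rewrite -h ltnNge Nc.
Qed.

(** Every triangle contains both [None] and its twin, so it is given by one of the [N.-1] other
    points; the points midway between the twins are the ones lost. *)
Lemma dl_co_size (lc : c < N) : co_size doubled_line + #|[pred j : 'I_N | e == 2 * ((j -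
  c) + (c - j))]| = N.-1.
Proof.
pose C : point doubled_line := Some (Ordinal lc).
pose D : point doubled_line := None.
have f2 : triangle_free ([set: point doubled_line] :\ C).
  apply: (inj_triangle_free dl_btE) => -[x|] [y|]; rewrite !inE ?andbT //=.
  - by move=> _ _ h; congr Some; apply: val_inj.
  - by move=> /eqP nx _ h; case: nx; congr Some; apply: val_inj.
  - by move=> _ /eqP ny h; case: ny; congr Some; apply: val_inj.
rewrite co_sizeE (@shared_tri_num _ _ C D) ?inE //; last exact: dl_triangle_free.
set K := _ :\ D.
have cK : #|K| = N.-1.
  have := cardsT (point doubled_line);
    rewrite card_dl (cardsD1 C) inE (cardsD1 D) !inE /= -/K.
  by clear; lia.
rewrite -cK -(col_card K C D) addnC; congr (_ + _).
set A := [pred j | _].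
have inj : injective (Some : 'I_N -> point doubled_line) by move=> x y [].
rewrite -(card_imset A inj); apply: eq_card => -[j|].
  rewrite (mem_imset _ _ inj) inE [in RHS]inE.
  have [ej|nj] := eqVneq j (Ordinal lc).
    by rewrite ej /K !inE -/C eqxx /= subnn addn0 muln0; clear -e12; lia.
  have nj' : j != c :> nat by apply: contraNneq nj => h; apply/eqP/val_inj.
  by rewrite (twin_noncol e12 dl_btE) //= negbK !inE -[Some j == C]/(j == Ordinal lc)
    (negPf nj).
by apply/idP/idP => [/imsetP[x _]//|]; rewrite /K !inE eqxx.
Qed.

End DoubledLine.

Lemma e1P : 0 < 1 <= 2. Proof. by []. Qed.
Lemma e2P : 0 < 2 <= 2. Proof. by []. Qed.

(** A four-cycle with a tail: positions 0 and 2 are midway between the twins, so the order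
    [n = N + 1] has [n - 4] triangles. *)
Lemma co_size_C4_tail N : 2 < N -> co_size (doubled_line N 1 e2P) + 3 = N.
Proof.
move=> N3; have lc : 1 < N by exact: ltnW.
have N0 : 0 < N by exact: ltnW.
have := dl_co_size e2P lc.
rewrite (eq_card (B := pred2 (Ordinal N0) (Ordinal N3))) => [|j].
  by rewrite card2 -val_eqE /=; clear -N3; lia.
by rewrite !inE -!val_eqE /=; clear; lia.
Qed.

(** A path with a doubled end: only position 1 is midway, which gives [n - 3] triangles. *)
Lemma co_size_fork N : 1 < N -> co_size (doubled_line N 0 e2P) + 2 = N.
Proof.
move=> N2; have N0 : 0 < N by exact: ltnW.
have := dl_co_size e2P N0.
rewrite (eq_card (B := pred1 (Ordinal N2))) => [|j].
  by rewrite card1; clear -N2; lia.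
by rewrite !inE -!val_eqE /=; clear; lia.
Qed.

(** Twins at odd distance 1 have no midpoint, which gives [n - 2] triangles. *)
Lemma co_size_K3_tail N : 0 < N -> co_size (doubled_line N 0 e1P) + 1 = N.
Proof.
move=> N0; have := dl_co_size e1P N0.
rewrite eq_card0 => [|j]; first by clear -N0; lia.
by rewrite !inE /=; clear; lia.
Qed.

(** * The triangles of T_(n,i) *)

Section TCoSize.

Variables (n i : nat).
Hypothesis n6 : 5 < n.
Hypothesis i0 : 0 < i.
Hypothesis i5 : i <= n - 5.

Local Notation T := (T_betweenness n i).
Local Notation q_ x := (inr x : point T).

Let E := T_btwE n6 i0 i5.

Lemma T_pos_eq (a b : point T) : T_pos i a = T_pos i b ->
  [\/ a = b, (a \in [:: q_ Qy; q_ Qz]) && (b \in [:: q_ Qy; q_ Qz])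
    | (a \in [:: q_ Qu; q_ Qv]) && (b \in [:: q_ Qu; q_ Qv])].
Proof.
case: a => [j|a]; case: b => [k|b] /=.
- by case: ltnP => ?; case: ltnP => ? h; try (by exfalso; pos_lia); constructor 1;
  congr inl; apply: val_inj => /=; pos_lia.
- by case: b => /=; case: ltnP => ? ?; exfalso; pos_lia.
- by case: a => /=; case: ltnP => ? ?; exfalso; pos_lia.
by case: a; case: b => //= h; try (by exfalso; clear -h; lia);
  first [by constructor 1|by constructor 2|by constructor 3].
Qed.

Lemma T_triangle_free (S : {set point T}) (a b : point T) :
  a \in [:: q_ Qy; q_ Qz] -> b \in [:: q_ Qu; q_ Qv] ->
    triangle_free ([set: point T] :\ a :\ b).
Proof.
move=> ha hb; apply: (inj_triangle_free E) => x y; rewrite !inE !andbT =>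
  /andP[xb xa] /andP[yb ya].
case/T_pos_eq => // /andP[hx hy].
  by move: ha hx hy xa ya; rewrite !inE => /orP[]/eqP-> /orP[]/eqP-> /orP[]/eqP->;
    rewrite ?eqxx.
by move: hb hx hy xb yb; rewrite !inE => /orP[]/eqP-> /orP[]/eqP-> /orP[]/eqP->;
  rewrite ?eqxx.
Qed.

Let lt_i : i < n - 4. Proof. by move: i5 n6; clear; lia. Qed.
Let lt_i1 : i.-1 < n - 4. Proof. by move: i5 n6; clear; lia. Qed.
Let before : point T := inl (Ordinal lt_i1).
Let after : point T := inl (Ordinal lt_i).

Lemma T_pos_before : T_pos i before = i.-1.
Proof. by rewrite /= prednK // leqnn. Qed.

Lemma T_pos_after : T_pos i after = i.+2.
Proof. by rewrite /= ltnn. Qed.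

Lemma T_noncol_yz (j : 'I_(n - 4)) : noncol (q_ Qy) (q_ Qz) (inl j) = (T_pos i (inl j :
  point T) != i.-1).
Proof.
rewrite (twin_noncol (isT : 0 < 2 <= 2) E) //=; first by case: ltnP; move: i0; clear; lia.
by case: ltnP => ?; [rewrite ltn_eqF|rewrite gtn_eqF // ltnS leqW].
Qed.

Lemma T_noncol_uv (j : 'I_(n - 4)) : noncol (q_ Qu) (q_ Qv) (inl j) = (T_pos i (inl j :
  point T) != i.+2).
Proof.
rewrite (twin_noncol (isT : 0 < 2 <= 2) E) //=; first by case: ltnP; move: i0; clear; lia.
by case: ltnP => h; [rewrite ltn_eqF // ltnW|rewrite gtn_eqF // !ltnS].
Qed.

Lemma T_noncol_yzu : noncol (q_ Qy) (q_ Qz) (q_ Qu) = false.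
Proof.
rewrite (twin_noncol (isT : 0 < 2 <= 2) E) //=; first by clear; lia.
by rewrite gtn_eqF.
Qed.

Lemma T_noncol_yzv : noncol (q_ Qy) (q_ Qz) (q_ Qv) = false.
Proof.
rewrite (twin_noncol (isT : 0 < 2 <= 2) E) //=; first by clear; lia.
by rewrite gtn_eqF.
Qed.

Lemma T_noncol_uvy : noncol (q_ Qu) (q_ Qv) (q_ Qy) = false.
Proof.
rewrite (twin_noncol (isT : 0 < 2 <= 2) E) //=; first by clear; lia.
by rewrite ltn_eqF.
Qed.

Lemma T_noncol_uvz : noncol (q_ Qu) (q_ Qv) (q_ Qz) = false.
Proof.
rewrite (twin_noncol (isT : 0 < 2 <= 2) E) //=; first by clear; lia.
by rewrite ltn_eqF.
Qed.

Lemma inl_posE (j : 'I_(n - 4)) (a : point T) :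
  (a == after) || (a == before) ->
    (T_pos i (inl j : point T) == T_pos i a) = ((inl j : point T) == a).
Proof.
move=> ha; apply/eqP/eqP => [|->//]; case/T_pos_eq => //; by rewrite !inE.
Qed.

(** Deleting v destroys just the triangles on [{u, v}], and the rest are those on [{y, z}]. Of the
    [n - 2] points outside [{u, v}], exactly y, z and x_(i+1) are collinear with u and v; without v,
    exactly x_i and u are collinear with y and z. This leaves [n - 5] triangles on each pair. *)
Lemma T_co_size : co_size T + 10 = 2 * n.
Proof.
rewrite co_sizeE; set S := [set: point T].
have cT : #|S| = n by rewrite cardsT; apply: card_T_vertex n6.
pose p := q_ Qz; pose z := q_ Qy; pose q := q_ Qv; pose r := q_ Qu.
have tf a b : a \in [:: q_ Qy; q_ Qz] -> b \in [:: q_ Qu; q_ Qv] ->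
  triangle_free (S :\ b :\ a).
  by move=> ha hb; rewrite setD1C; apply: T_triangle_free.
have qS : q \in S by rewrite inE.
have rS : r \in S :\ q by rewrite !inE.
have pS : p \in S :\ q by rewrite !inE.
have zS : z \in S :\ q by rewrite !inE.
have zS' : z \in S :\ q :\ p by rewrite !inE.
have npz : p != z by [].
have h1 := tri_numD1 qS; rewrite (link_degD1 _ rS) in h1.
have d0 : link_deg (S :\ q :\ r) q = 0.
  apply: big1 => x xS; apply: big1 => y yS; apply/eqP; rewrite eqb0.
  have tz := @T_triangle_free S z r isT isT; have tp := @T_triangle_free S p r isT isT.
  move: xS yS; rewrite !inE !andbT => /andP[xr xq] /andP[yr yq].
  have [/andP[xp yp]|h] := boolP ((x != p) && (y != p)).
    by apply: tp; rewrite !inE ?andbT ?xr ?yr ?xp ?yp.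
  have [/andP[xz yz]|h'] := boolP ((x != z) && (y != z)).
    by apply: tz; rewrite !inE ?andbT ?xr ?yr ?xz ?yz.
  rewrite !negb_and !negbK in h h'.
  case/orP: h => /eqP e1; case/orP: h' => /eqP e2; rewrite e1 // in e2 *.
  - by rewrite e2 noncol_rot noncol_swap; exact: negbT T_noncol_yzv.
  - by rewrite e2 noncol_rot; exact: negbT T_noncol_yzv.
have fz : triangle_free (S :\ q :\ z) by apply: tf.
have fp : triangle_free (S :\ q :\ p) by apply: tf.
have h2 := shared_tri_num pS zS npz fp fz.
have c1 := cardsD1 q S; have c2 := cardsD1 r (S :\ q).
have c3 := cardsD1 p (S :\ q); have c4 := cardsD1 z (S :\ q :\ p).
rewrite qS in c1; rewrite rS in c2; rewrite pS in c3; rewrite zS' in c4.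
have k1 := col_card (S :\ q :\ p :\ z) p z.
have k2 := col_card (S :\ q :\ r) q r.
have e1 : #|[set k in S :\ q :\ p :\ z | ~~ noncol p z k]| = 2.
  rewrite (_ : [set k in _ | _] = [set before; r]) ?cards2 //.
  apply/setP => -[j|[]];
    rewrite !inE //= noncol_swap ?T_noncol_yzu // T_noncol_yz negbK -T_pos_before.
  by rewrite inl_posE ?eqxx ?orbT //= orbF.
have e2 : #|[set k in S :\ q :\ r | ~~ noncol q r k]| = 3.
  rewrite (_ : [set k in _ | _] = [set z; p; after]); first by rewrite card3E.
  apply/setP => -[j|[]];
    rewrite !inE //= noncol_swap ?T_noncol_uvy ?T_noncol_uvz // T_noncol_uv negbK
    -T_pos_after.
  by rewrite inl_posE ?eqxx ?orbT.
by rewrite d0 h2 in h1; move: h1 c1 c2 c3 c4 k1 k2; rewrite cT e1 e2; move: n6; clear;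
  lia.
Qed.

Lemma T_disjoint_triangles : exists a b c a' b' c' : point T,
  [/\ noncol a b c, noncol a' b' c' & uniq [:: a; b; c; a'; b'; c']].
Proof.
exists (q_ Qy), (q_ Qz), after, (q_ Qu), (q_ Qv), before.
rewrite T_noncol_yz T_noncol_uv T_pos_before T_pos_after; split.
- by clear; lia.
- by clear; lia.
rewrite /= !inE /=; rewrite -[after == before]/(i == i.-1) -?[before == after]/(i.-1 ==
  i).
by move: i0; clear; lia.
Qed.

End TCoSize.

(* All triangles of a doubled line contain [None], whereas [T_(n,i)] has two
   disjoint triangles. *)
Lemma doubled_line_not_T N c e (e12 : 0 < e <= 2) n i : 5 < n -> 0 < i -> i <= n - 5 ->
  ~ isomorphic (doubled_line N c e12) (T_betweenness n i).
Proof.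
move=> n6 i0 i5 [f [[g fK gK] fE]].
have nE x y z : noncol (g x) (g y) (g z) = noncol x y z.
  have bE a b c' : between (g a) (g b) (g c') = between a b c'.
    by apply/idP/idP => [/fE|h]; rewrite ?gK //; apply/fE; rewrite !gK.
  by rewrite /noncol !bE.
have hN (x y z : point (doubled_line N c e12)) : noncol x y z -> [|| x == None,
  y == None | z == None].
  move=> h; apply: contraT; rewrite !negb_or => /and3P[x0 y0 z0].
  have := @dl_triangle_free N c e e12 x y z.
  by rewrite !in_setD1 x0 y0 z0 !inE h => /(_ isT isT isT).
have [a [b [c' [u [v [w [n1 n2 un]]]]]]] := T_disjoint_triangles n6 i0 i5.
have N1 : f None \in [:: a; b; c'].
  by move: n1; rewrite -nE => /hN /or3P[]/eqP <-; rewrite gK !inE eqxx ?orbT.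
have N2 : f None \in [:: u; v; w].
  by move: n2; rewrite -nE => /hN /or3P[]/eqP <-; rewrite gK !inE eqxx ?orbT.
move: un; rewrite -[[:: a, b & _]]/([:: a; b; c'] ++ [:: u; v; w]) cat_uniq.
by case/and3P=> _ /hasPn/(_ _ N2); rewrite /= N1.
Qed.

(** Moving [c] to the other side keeps everything in [nat]; a negative [2n - c] is no co-size on
    either side. *)
Lemma in_BP n c B : in_B n ((2 * n)%:Z - c%:Z)%R B <->
  #|point B| = n /\ co_size B + c = 2 * n.
Proof. by rewrite /in_B; split=> -[h1 h2]; split=> //; move: h2; clear; lia. Qed.

(* [uphalf k] is the ceiling of k / 2. *)
Theorem theorem6 :
  (forall c n : nat, 11 <= c -> 0 < n ->
     (exists B : betweenness, in_B n ((2 * n)%:Z - c%:Z)%R B) <->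
     (2 * n = c \/ c - 4 <= n <= c - 2))
  /\
  ((forall n : nat, 0 < n ->
      (exists B : betweenness, in_B n ((2 * n)%:Z - 10%:Z)%R B) <-> 5 <= n)
   /\
   (forall (n : nat) (B : betweenness), 9 <= n ->
      in_B n ((2 * n)%:Z - 10%:Z)%R B ->
      exists i : nat, 1 <= i <= uphalf (n - 5) /\
        isomorphic B (T_betweenness n i)))
  /\
  (forall n : nat, 6 <= n < 9 ->
     exists B : betweenness, in_B n ((2 * n)%:Z - 10%:Z)%R B /\
       forall i : nat, 1 <= i <= uphalf (n - 5) ->
         ~ isomorphic B (T_betweenness n i)).
Proof.
(* The goals are rotated: claims (2) and (3) come before claim (1). *)
split; last split; first 1 last.
- split=> [n n0|n B n9 /in_BP[cB hB]].
    split=> [[B /in_BP[_ h]]|n5]; first by move: h; clear; lia.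
    have [n9|n9] := leqP 9 n.
      exists (T_betweenness n 1); apply/in_BP; split.
        by apply: card_T_vertex; clear -n9; lia.
      by apply: T_co_size => //; clear -n9; lia.
    have : [\/ n = 5, n = 6, n = 7 | n = 8].
      case: n n5 n9 {n0} => [|[|[|[|[|[|[|[|[|]]]]]]]]] // _ _;
        by [constructor 1|constructor 2|constructor 3|constructor 4].
    (* At [n = 5] the co-size is 0, realized by a line; at [n = 6], [7], [8] it is [n - 4], [n - 3],
       [n - 2], realized by the three doubled lines. *)
    case=> ->.
    + exists (doubled_line 4 4 e2P); apply/in_BP; rewrite card_dl; split=> //.
      by rewrite dl_line.
    + exists (doubled_line 5 1 e2P); apply/in_BP; rewrite card_dl; split=> //.
      by have := @co_size_C4_tail 5 isT; clear; lia.
    + exists (doubled_line 6 0 e2P); apply/in_BP; rewrite card_dl; split=> //.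
      by have := @co_size_fork 6 isT; clear; lia.
    + exists (doubled_line 7 0 e1P); apply/in_BP; rewrite card_dl; split=> //.
      by have := @co_size_K3_tail 7 isT; clear; lia.
  have c8 : 8 < #|[set: point B]| by rewrite cardsT cB.
  have hm : tri_num [set: point B] + 10 = 2 * #|[set: point B]| by rewrite cardsT cB -co_sizeE.
  have [p [z [q [r cf]]]] := extremal_config c8 hm.
  have [P [i h]] : exists P i, exists p z q r : point B, model P (#|point B| - 2) i p z q r.
    have [|P [i [h|h]]] := config_model cf; first by rewrite cB.
      by exists P, i, p, z, q, r.
    by exists P, i, q, r, p, z.
  have [i' [P' [p' [z' [q' [r' [hi hi' h']]]]]]] : exists i' P' p' z' q' r',
      [/\ 0 < i', i' <= uphalf (n - 5) & model (B := B) P' (n - 2) i' p' z' q' r'].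
    case: h => p1 [z1 [q1 [r1 h]]]; rewrite cB in h.
    have [_ _ _ _ [i0 iN _]] := h.
    (* Reversal replaces [i] by [n - 4 - i], which falls in the lower half whenever [i] does not. *)
    have [le|gt] := leqP i (uphalf (n - 5)); first by exists i, P, p1, z1, q1, r1.
    exists (n - 2 - i.+2), (fun x => (n - 2).-1 - P x), q1, r1, p1, z1; split.
    - by move: iN; clear; lia.
    - move: gt iN; rewrite uphalf_half; have := odd_double_half (n - 5).
      by move: n9; clear; rewrite -muln2; lia.
    - exact: model_flip.
  exists i'; split; first by rewrite hi.
  have := model_iso h'; rewrite subnK //; move: n9; clear; lia.
- move=> n /andP[n6 n9].
  have not_T N c e (e12 : 0 < e <= 2) : forall i, 1 <= i <= uphalf (n - 5) ->
      ~ isomorphic (doubled_line N c e12) (T_betweenness n i).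
    move=> i /andP[i0 i5]; apply: doubled_line_not_T => //; apply: leq_trans i5 _.
    by rewrite uphalf_half -[leqRHS]odd_double_half -muln2; lia.
  have : [\/ n = 6, n = 7 | n = 8].
    case: n n6 n9 {not_T} => [|[|[|[|[|[|[|[|[|]]]]]]]]] // _ _;
      by [constructor 1|constructor 2|constructor 3].
  case=> e.
  + exists (doubled_line 5 1 e2P); split; last exact: not_T.
    apply/in_BP; rewrite card_dl e; split=> //.
    by have := @co_size_C4_tail 5 isT; clear; lia.
  + exists (doubled_line 6 0 e2P); split; last exact: not_T.
    apply/in_BP; rewrite card_dl e; split=> //.
    by have := @co_size_fork 6 isT; clear; lia.
  + exists (doubled_line 7 0 e1P); split; last exact: not_T.
    apply/in_BP; rewrite card_dl e; split=> //.
    by have := @co_size_K3_tail 7 isT; clear; lia.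
- move=> c n c11 n0; split=> [[B /in_BP[cB hB]]|].
    (* Co-size 0 is the case [n = c / 2]. A positive co-size forces [n >= 6], and [c >= 11] makes
       the structure shared. *)
    have [m0|m0] := posnP (co_size B); first by left; rewrite -hB m0.
    right; rewrite co_sizeE in hB m0.
    have cS : #|[set: point B]| = (n - 6) + 6 by rewrite cardsT cB; move: hB c11 m0; clear; lia.
    have sh : shared [set: point B].
      by apply: (shared_lt cS); rewrite cardsT cB; move: hB c11; clear; lia.
    have up := shared_upper sh.
    have [|e|lo] := shared_count _ sh; first by rewrite cS; clear; lia.
      by rewrite e in m0.
    by rewrite cardsT cB in up lo; move: up lo hB c11; clear; lia.
  have [N eN] : exists N, n = N.+1 by exists n.-1; rewrite prednK.
  case=> [e2|/andP[lo hi]].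
    exists (doubled_line N N e2P); apply/in_BP; rewrite card_dl; split=> //.
    by rewrite dl_line.
  have : [\/ n + 4 = c, n + 3 = c | n + 2 = c].
    have : n + 4 = c \/ n + 3 = c \/ n + 2 = c by move: lo hi c11; clear; lia.
    by case=> [|[]]; [constructor 1|constructor 2|constructor 3].
  case=> e.
  + exists (doubled_line N 1 e2P); apply/in_BP; rewrite card_dl; split=> //.
    have N3 : 2 < N by move: e eN c11; clear; lia.
    by have := co_size_C4_tail N3; move: e eN; clear; lia.
  + exists (doubled_line N 0 e2P); apply/in_BP; rewrite card_dl; split=> //.
    have N3 : 1 < N by move: e eN c11; clear; lia.
    by have := co_size_fork N3; move: e eN; clear; lia.
  + exists (doubled_line N 0 e1P); apply/in_BP; rewrite card_dl; split=> //.
    have N3 : 0 < N by move: e eN c11; clear; lia.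
    by have := co_size_K3_tail N3; move: e eN; clear; lia.
Qed.
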